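(* Let $A=KQ/\langle Z\rangle$ be a folded gentle algebra, where $(K,Q,Z)$ is a folded gentle triple. (a) Let $M$ be a left $A$-module and let $0\neq m\in M$ be such that $\varepsilon_v m=m$ for some $v\in Q_0$. Then the submodule $Am=\langle am : a\in A\rangle\subseteq M$ is biserial. (b) Let $M$ be a right $A$-module and let $0\neq m\in M$ be such that $m\varepsilon_v=m$ for some $v\in Q_0$. Then the submodule $mA=\langle ma : a\in A\rangle\subseteq M$ is biserial. Consequently, $A$ is a biserial algebra.
   Context: Paths in a quiver compose left to right: $\alpha_1\cdots\alpha_n$ is a path iff $t(\alpha_i)=s(\alpha_{i+1})$; $\varepsilon_v$ is the stationary path at $v$. Folded gentle triple $(K,Q,Z)$: $K$ is a field; $Q$ is a finite quiver with $Q_0=Q_0^{(1)}\sqcup Q_0^{(2)}$ (ordinary and crease vertices) and $Q_1=Q_1^{(1)}\sqcup Q_1^{(2)}$ (ordinary arrows and crease loops), where $Q_1^{(2)}=\{\eta_v : v\in Q_0^{(2)}\}$ with $\eta_v$ a loop at $v$; $Z=Z^{(1)}\sqcup Z^{(2)}\subseteq KQ$, where $Z^{(1)}$ is a set of paths of length at least $2$ in $Q\setminus Q_1^{(2)}$ and $Z^{(2)}=\{\eta_v^2-\lambda_{v,1}\eta_v-\lambda_{v,2}\varepsilon_v : v\in Q_0^{(2)}\}$ with $\lambda_{v,1},\lambda_{v,2}\in K$; such that: (FG1) every vertex is the source of at most two arrows and the target of at most two arrows; (FG2) for each $\beta\in Q_1^{(1)}$ there is at most one $\alpha\in Q_1$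 with $\alpha\beta$ a path not in $Z^{(1)}$ and at most one $\gamma\in Q_1$ with $\beta\gamma$ a path not in $Z^{(1)}$; (FG3) for each $\beta\in Q_1^{(1)}$ there is at most one $\alpha\in Q_1$ with $\alpha\beta\in Z^{(1)}$ and at most one $\gamma\in Q_1$ with $\beta\gamma\in Z^{(1)}$; (FG4) all elements of $Z^{(1)}$ have length $2$; (FG5) each polynomial $x^2-\lambda_{v,1}x-\lambda_{v,2}$ is irreducible over $K$. It is assumed that $Q_0^{(2)}\neq\emptyset$ and that $KQ/\langle Z\rangle$ is finite-dimensional. A (left or right) module $M$ over a finite-dimensional algebra is uniserial if it has a unique composition series, equivalently $\operatorname{rad}^iM/\operatorname{rad}^{i+1}M$ is simple or zero for each $i$. It is biserial if there are (possibly trivial) uniserial submodules $U_1,U_2\subseteq M$ such that $\operatorname{rad}M\cong U_1+U_2$ and $U_1\cap U_2$ is simple or zero. A finite-dimensional algebra is biserial if every left and every right indecomposable projective module is biserial. *)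

(* Defs.v *)
From HB Require Import structures.
From mathcomp Require Import all_boot all_order all_algebra.
From mathcomp Require Import finmap.
From mathcomp Require Import boolp classical_sets functions.
From mathcomp Require Import monalg.

Set Implicit Arguments.
Unset Strict Implicit.
Unset Printing Implicit Defensive.

Import GRing.Theory.

Local Open Scope classical_set_scope.
Local Open Scope ring_scope.
Local Open Scope quotient_scope.

Record quiver := Quiver {
  vertex : finType;
  arrow : finType;
  src : arrow -> vertex;
  tgt : arrow -> vertex }.

Section Paths.
Variable Q : quiver.

Fixpoint walk (v : vertex Q) (s : seq (arrow Q)) : bool :=
  if s is a :: s' then (src a == v) && walk (tgt a) s' else true.

(* A path is its source together with its arrows, read from left to right;
   the source is only needed to tell the stationary paths apart. *)
Record qpath := QPath {
  qpath_val : vertex Q * seq (arrow Q);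
  qpath_walk : walk qpath_val.1 qpath_val.2 }.

HB.instance Definition _ := [isSub for qpath_val].
HB.instance Definition _ := [Choice of qpath by <:].

Definition psrc (p : qpath) : vertex Q := (qpath_val p).1.
Definition arrows (p : qpath) : seq (arrow Q) := (qpath_val p).2.
Definition ptgt (p : qpath) : vertex Q :=
  last (psrc p) [seq tgt a | a <- arrows p].

Definition stationary (v : vertex Q) : qpath := @QPath (v, [::]) isT.

Lemma arrow_walk (a : arrow Q) : walk (src a) [:: a].
Proof. by rewrite /= eqxx. Qed.

Definition arrow_path (a : arrow Q) : qpath := @QPath (src a, [:: a]) (arrow_walk a).

(* [None] exactly when the concatenation is not a path, see [pcatP]. *)
Definition pcat (p q : qpath) : option qpath :=
  if ptgt p == psrc q then insub (psrc p, arrows p ++ arrows q) else None.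

Lemma walk_cat v s1 s2 :
  walk v (s1 ++ s2) = walk v s1 && walk (last v [seq tgt a | a <- s1]) s2.
Proof. by elim: s1 v => //= a s IH v; rewrite IH andbA. Qed.

Lemma pcatP (p q : qpath) :
  if ptgt p == psrc q
  then exists2 r, pcat p q = Some r & psrc r = psrc p /\ arrows r = arrows p ++ arrows q
  else pcat p q = None.
Proof.
rewrite /pcat; case: eqP => // e.
have w : walk (psrc p, arrows p ++ arrows q).1 (psrc p, arrows p ++ arrows q).2.
  by rewrite /= walk_cat (qpath_walk p) -/(ptgt p) e (qpath_walk q).
by exists (QPath w) => //; rewrite insubT.
Qed.

End Paths.

(* Locked, because unification is otherwise lost in finitely supported functions. *)
HB.lock Definition pbase (K : fieldType) (Q : quiver) (p : qpath Q) :
  {malg K[qpath Q]} := << p >>.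

HB.lock Definition pmul_basis (K : fieldType) (Q : quiver) (p q : qpath Q) :
  {malg K[qpath Q]} := if pcat p q is Some r then pbase K r else 0.

HB.lock Definition pmul (K : fieldType) (Q : quiver) (f g : {malg K[qpath Q]}) :
  {malg K[qpath Q]} :=
  \sum_(p <- msupp f) \sum_(q <- msupp g) (f@_p * g@_q) *: pmul_basis K p q.

Section PathAlgebra.
Variables (K : fieldType) (Q : quiver).

Local Notation malgQ := {malg K[qpath Q]}.
Local Notation pbase := (@pbase K Q).
Local Notation pmul_basis := (@pmul_basis K Q).
Local Notation pmul := (@pmul K Q).

Definition pone : malgQ := \sum_(v : vertex Q) pbase (stationary v).

Lemma malgUE (c : K) (p : qpath Q) : << c *g p >> = c *: pbase p.
Proof.
rewrite pbase.unlock; apply/malgP => k; apply: etrans (mcoeffU p c k) _.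
apply: etrans (esym (mcoeffZ c _ k)).
by rewrite (mcoeffU p 1 k) mulrnAr mulr1.
Qed.

Lemma pmulw (d1 d2 : {fset qpath Q}) f g :
  (msupp f `<=` d1)%fset -> (msupp g `<=` d2)%fset ->
  pmul f g = \sum_(p <- d1) \sum_(q <- d2) (f@_p * g@_q) *: pmul_basis p q.
Proof.
move=> le1 le2; rewrite pmul.unlock (big_fset_incl _ le1) /=; last first.
  move=> p _ /mcoeff_outdom ->.
  by rewrite big1 // => q _; rewrite mul0r scale0r.
apply: eq_bigr => p _; rewrite (big_fset_incl _ le2) //= => q _.
by move=> /mcoeff_outdom ->; rewrite mulr0 scale0r.
Qed.

Lemma pmul_linearl g : linear (pmul^~ g).
Proof.
move=> c f1 f2 /=.
set d := (msupp f1 `|` msupp f2 `|` msupp (c *: f1 + f2))%fset.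
rewrite !(@pmulw d (msupp g)) ?fsubsetUr //; first last.
- by rewrite /d -fsetUA fsubsetUl.
- by rewrite /d fsetUAC fsubsetUr.
rewrite scaler_sumr -big_split; apply: eq_bigr => p _ /=.
rewrite scaler_sumr -big_split; apply: eq_bigr => q _ /=.
by rewrite mcoeffD mcoeffZ mulrDl scalerDl scalerA mulrA.
Qed.

Lemma pmul_linearr f : linear (pmul f).
Proof.
move=> c g1 g2 /=.
set d := (msupp g1 `|` msupp g2 `|` msupp (c *: g1 + g2))%fset.
rewrite !(@pmulw (msupp f) d) ?fsubsetUr //; first last.
- by rewrite /d -fsetUA fsubsetUl.
- by rewrite /d fsetUAC fsubsetUr.
rewrite scaler_sumr -big_split; apply: eq_bigr => p _ /=.
rewrite scaler_sumr -big_split; apply: eq_bigr => q _ /=.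
by rewrite mcoeffD mcoeffZ mulrDr scalerDl scalerA mulrCA.
Qed.

Lemma malg_ext (F G : malgQ -> malgQ) :
  linear F -> linear G -> (forall p, F (pbase p) = G (pbase p)) -> F =1 G.
Proof.
move=> linF linG FG f.
pose F' := GRing.isLinear.Build K malgQ malgQ *:%R F linF.
pose G' := GRing.isLinear.Build K malgQ malgQ *:%R G linG.
pose FF : {linear malgQ -> malgQ} := HB.pack F F'.
pose GG : {linear malgQ -> malgQ} := HB.pack G G'.
rewrite -[F]/(FF : _ -> _) -[G]/(GG : _ -> _) (monalgE f) !linear_sum.
by apply: eq_bigr => p _; rewrite malgUE !linearZ /= FG.
Qed.

Lemma pmulUU p q : pmul (pbase p) (pbase q) = pmul_basis p q.
Proof.
rewrite (@pmulw [fset p]%fset [fset q]%fset) ?pbase.unlock ?msuppU_le //.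
by rewrite !big_seq_fset1 !mcoeffUU mulr1 scale1r.
Qed.

Lemma pmul0l g : pmul 0 g = 0.
Proof. by rewrite pmul.unlock msupp0 big_nil. Qed.

Lemma pmul0r f : pmul f 0 = 0.
Proof. by rewrite pmul.unlock big1 // => p _; rewrite msupp0 big_nil. Qed.

Lemma ptgt_cat (p q r : qpath Q) : ptgt p = psrc q ->
  psrc r = psrc p -> arrows r = arrows p ++ arrows q -> ptgt r = ptgt q.
Proof. by move=> e; rewrite /ptgt => -> ->; rewrite map_cat last_cat -/(ptgt p) e. Qed.

Lemma qpath_eq (p q : qpath Q) : psrc p = psrc q -> arrows p = arrows q -> p = q.
Proof.
move=> e1 e2; apply: val_inj => /=.
by rewrite [LHS]surjective_pairing [RHS]surjective_pairing; congr pair.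
Qed.

Lemma pmul_basis_some p q : ptgt p = psrc q ->
  exists r, [/\ pmul_basis p q = pbase r, psrc r = psrc p, ptgt r = ptgt q
              & arrows r = arrows p ++ arrows q].
Proof.
move=> e; have := pcatP p q; rewrite e eqxx => -[r er [r1 r2]].
by exists r; split=> //; [rewrite pmul_basis.unlock er|exact: ptgt_cat e r1 r2].
Qed.

Lemma pmul_basis_none p q : ptgt p <> psrc q -> pmul_basis p q = 0.
Proof.
by move=> /eqP/negPf e; have := pcatP p q; rewrite pmul_basis.unlock e => ->.
Qed.

Lemma pmul_basisA p q r :
  pmul (pbase p) (pmul_basis q r) = pmul (pmul_basis p q) (pbase r).
Proof.
case: (ptgt q =P psrc r) => [e1|e1]; case: (ptgt p =P psrc q) => [e2|e2].
- have [s [-> s1 s2 s3]] := pmul_basis_some e1.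
  have [t [-> t1 t2 t3]] := pmul_basis_some e2.
  rewrite (pmulUU p s) (pmulUU t r).
  have [|x [-> x1 x2 x3]] := @pmul_basis_some p s; first by rewrite s1.
  have [|y [-> y1 y2 y3]] := @pmul_basis_some t r; first by rewrite t2.
  congr pbase; apply: qpath_eq; first by rewrite x1 y1.
  by rewrite x3 y3 t3 s3 catA.
- have [s [-> s1 s2 s3]] := pmul_basis_some e1.
  rewrite (pmul_basis_none e2) (pmul0l (pbase r)) (pmulUU p s).
  by apply: pmul_basis_none; rewrite s1.
- have [t [-> t1 t2 t3]] := pmul_basis_some e2.
  rewrite (pmul_basis_none e1) (pmul0r (pbase p)) (pmulUU t r).
  by symmetry; apply: pmul_basis_none; rewrite t2.
- by rewrite (pmul_basis_none e1) (pmul_basis_none e2) (pmul0l (pbase r)) (pmul0r (pbase p)).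
Qed.

Lemma pmulA : associative pmul.
Proof.
move=> f g h; move: f; apply: malg_ext => [c x y|c x y|p].
- exact: pmul_linearl.
- by rewrite (pmul_linearl g c x y); exact: pmul_linearl.
move: g; apply: malg_ext => [c x y|c x y|q].
- by rewrite (pmul_linearl h c x y); exact: pmul_linearr.
- by rewrite (pmul_linearr (pbase p) c x y); exact: pmul_linearl.
move: h; apply: malg_ext => [c x y|c x y|r].
- by rewrite (pmul_linearr (pbase q) c x y); exact: pmul_linearr.
- exact: pmul_linearr.
by rewrite (pmulUU q r) (pmulUU p q) pmul_basisA.
Qed.

Lemma pmulDl : left_distributive pmul +%R.
Proof.
move=> x y z; have := pmul_linearl z 1 x y.
by rewrite (scale1r x) (scale1r (pmul x z)).
Qed.

Lemma pmulDr : right_distributive pmul +%R.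
Proof.
move=> x y z; have := pmul_linearr x 1 y z.
by rewrite (scale1r y) (scale1r (pmul x y)).
Qed.

Lemma pmul_scalel c f g : pmul (c *: f) g = c *: pmul f g.
Proof.
rewrite -[X in pmul X _]addr0; apply: etrans (pmul_linearl g c f 0) _.
by rewrite (pmul0l g); exact: addr0.
Qed.

Lemma pmul_suml g (F : vertex Q -> malgQ) :
  pmul (\sum_v F v) g = \sum_v pmul (F v) g.
Proof.
apply: (big_morph (pmul^~ g)) => [x y|]; [exact: pmulDl|exact: pmul0l].
Qed.

Lemma pmul_sumr f (F : vertex Q -> malgQ) :
  pmul f (\sum_v F v) = \sum_v pmul f (F v).
Proof.
apply: (big_morph (pmul f)) => [x y|]; [exact: pmulDr|exact: pmul0r].
Qed.

Lemma pmul1l : left_id pone pmul.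
Proof.
apply: malg_ext => [||p]; [exact: pmul_linearr|by []|].
rewrite pmul_suml (bigD1 (psrc p)) //= big1 => [|v vp].
  rewrite addr0 (pmulUU (stationary (psrc p)) p).
  have [|r [-> r1 r2 r3]] := @pmul_basis_some (stationary (psrc p)) p; first by [].
  by congr pbase; exact: qpath_eq.
rewrite (pmulUU (stationary v) p); apply: pmul_basis_none; exact/eqP.
Qed.

Lemma pmul1r : right_id pone pmul.
Proof.
apply: malg_ext => [||p]; [exact: pmul_linearl|by []|].
rewrite pmul_sumr (bigD1 (ptgt p)) //= big1 => [|v vp].
  rewrite addr0 (pmulUU p (stationary (ptgt p))).
  have [|r [-> r1 r2 r3]] := @pmul_basis_some p (stationary (ptgt p)); first by [].
  by congr pbase; apply: qpath_eq; rewrite // r3 cats0.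
rewrite (pmulUU p (stationary v)); apply: pmul_basis_none => e.
by rewrite e eqxx in vp.
Qed.

Definition path_algebra : Type := malgQ.
HB.instance Definition _ := GRing.Lmodule.on path_algebra.

(* Only a [pzRingType]: KQ is the zero ring when Q has no vertex. *)
HB.instance Definition _ := GRing.Zmodule_isPzRing.Build path_algebra
  pmulA pmul1l pmul1r pmulDl pmulDr.

Definition pelt (p : qpath Q) : path_algebra := pbase p.
Definition peps (v : vertex Q) : path_algebra := pelt (stationary v).
Definition parr (a : arrow Q) : path_algebra := pelt (arrow_path a).

Lemma path_scalerAl c (f g : path_algebra) : (c *: f) * g = c *: (f * g).
Proof. exact: pmul_scalel. Qed.

End PathAlgebra.

Definition two_sided_ideal (R : pzRingType) (I : set R) : Prop :=
  [/\ I 0, forall x y, I x -> I y -> I (x - y)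
    & forall a x, I x -> I (a * x) /\ I (x * a)].

Section PathAlgebraQuotient.
Variables (K : fieldType) (Q : quiver) (S : set (path_algebra K Q)).
Local Notation KQ := (path_algebra K Q).

Definition ideal_gen : set KQ := smallest (@two_sided_ideal KQ) S.

Lemma ideal_gen_ideal : two_sided_ideal ideal_gen.
Proof.
split=> [I [[]]//|x y Ix Iy I II|a x Ix].
  by have [[_ h _] _] := II; apply: h; [exact: Ix|exact: Iy].
by split=> I II; have [[_ _ h] _] := II; have [] := h a x (Ix I II).
Qed.

Definition ideal_pred : {pred KQ} := fun x => `[< ideal_gen x >].

Lemma ideal_pred_zmod : zmod_closed ideal_pred.
Proof.
have [I0 IB _] := ideal_gen_ideal.
by split=> [|x y /asboolP Ix /asboolP Iy]; apply/asboolP; [|apply: IB].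
Qed.
HB.instance Definition _ := GRing.isZmodClosed.Build KQ ideal_pred ideal_pred_zmod.

Definition quot_algebra : Type := Quotient.quot (ideal_pred : zmodClosed KQ).
HB.instance Definition _ := GRing.Zmodule.on quot_algebra.

Definition qproj (x : KQ) : quot_algebra :=
  \pi_(Quotient.quot (ideal_pred : zmodClosed KQ)) x.
Definition qrepr (x : quot_algebra) : KQ :=
  repr (x : Quotient.quot (ideal_pred : zmodClosed KQ)).

Lemma qreprK : cancel qrepr qproj. Proof. exact: reprK. Qed.

Lemma qprojE x y : qproj x = qproj y <-> ideal_gen (x - y).
Proof.
have e := Quotient.idealrBE (ideal_pred : zmodClosed KQ) x y.
split=> [xy|Ixy].
  by apply/asboolP; rewrite -/(ideal_pred _) -[ideal_pred _]/(_ \in ideal_pred) e; apply/eqP.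
by apply/eqP; rewrite -e; apply/asboolP.
Qed.

Lemma qprojD x y : qproj (x + y) = qproj x + qproj y.
Proof. by rewrite /qproj raddfD. Qed.

Definition qone : quot_algebra := qproj 1.
Definition qmul (x y : quot_algebra) : quot_algebra := qproj (qrepr x * qrepr y).
Definition qscale (c : K) (x : quot_algebra) : quot_algebra := qproj (c *: qrepr x).

Lemma qprojM x y : qproj (x * y) = qmul (qproj x) (qproj y).
Proof.
have [I0 IB IM] := ideal_gen_ideal.
apply/qprojE; set x' := qrepr _; set y' := qrepr _.
have Ix : ideal_gen (x - x') by apply/qprojE; rewrite qreprK.
have Iy : ideal_gen (y - y') by apply/qprojE; rewrite qreprK.
have -> : x * y - x' * y' = (x - x') * y - (0 - x' * (y - y')).
  by rewrite sub0r opprK mulrBl mulrBr addrA subrK.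
apply: (IB _ _ (IM _ _ Ix).2); exact: IB I0 (IM _ _ Iy).1.
Qed.

Lemma qprojZ c x : qproj (c *: x) = qscale c (qproj x).
Proof.
have [I0 IB IM] := ideal_gen_ideal.
apply/qprojE; rewrite -scalerBr.
have Ix : ideal_gen (x - qrepr (qproj x)) by apply/qprojE; rewrite qreprK.
by rewrite -[_ - _]mul1r -path_scalerAl; apply: (IM _ _ Ix).1.
Qed.

Lemma qmulA : associative qmul.
Proof.
move=> x y z; rewrite -(qreprK x) -(qreprK y) -(qreprK z).
by rewrite -!qprojM mulrA.
Qed.

Lemma qmul1l : left_id qone qmul.
Proof. by move=> x; rewrite -(qreprK x) -qprojM mul1r. Qed.

Lemma qmul1r : right_id qone qmul.
Proof. by move=> x; rewrite -(qreprK x) -qprojM mulr1. Qed.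

Lemma qmulDl : left_distributive qmul +%R.
Proof.
move=> x y z; rewrite -(qreprK x) -(qreprK y) -(qreprK z).
by rewrite -qprojD -!qprojM -qprojD mulrDl.
Qed.

Lemma qmulDr : right_distributive qmul +%R.
Proof.
move=> x y z; rewrite -(qreprK x) -(qreprK y) -(qreprK z).
by rewrite -qprojD -!qprojM -qprojD mulrDr.
Qed.

HB.instance Definition _ := GRing.Zmodule_isPzRing.Build quot_algebra
  qmulA qmul1l qmul1r qmulDl qmulDr.

Lemma qscaleA a b x : qscale a (qscale b x) = qscale (a * b) x.
Proof. by rewrite -(qreprK x) -!qprojZ scalerA. Qed.

Lemma qscale1 : left_id 1 qscale.
Proof. by move=> x; rewrite -(qreprK x) -qprojZ scale1r. Qed.

Lemma qscaleDr : right_distributive qscale +%R.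
Proof.
move=> c x y; rewrite -(qreprK x) -(qreprK y).
by rewrite -qprojD -!qprojZ -qprojD scalerDr.
Qed.

Lemma qscaleDl x : {morph qscale^~ x : a b / a + b}.
Proof. by move=> a b; rewrite -(qreprK x) -!qprojZ -qprojD scalerDl. Qed.

HB.instance Definition _ := GRing.Zmodule_isLmodule.Build K quot_algebra
  qscaleA qscale1 qscaleDr qscaleDl.

End PathAlgebraQuotient.

Definition finite_dim (K : fieldType) (V : lmodType K) : Prop :=
  exists (n : nat) (b : 'I_n -> V),
    forall x, exists c : 'I_n -> K, x = \sum_(i < n) c i *: b i.

Section Submodules.
Variables (R : pzRingType) (M : lmodType R).
Implicit Types (L N X : set M).

Definition submodule N : Prop :=
  N 0 /\ forall (a : R) x y, N x -> N y -> N (a *: x + y).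

Definition cyclic_submodule (m : M) : set M :=
  smallest submodule [set a *: m | a in [set: R]].

Definition simple_module N : Prop :=
  [/\ submodule N, N <> [set 0]
    & forall X, submodule X -> X `<=` N -> X = [set 0] \/ X = N].

(* L is a maximal proper submodule of N, that is, the factor N / L is simple. *)
Definition maximal_submodule L N : Prop :=
  [/\ submodule L, submodule N, L `<=` N, L <> N
    & forall X, submodule X -> L `<=` X -> X `<=` N -> X = L \/ X = N].

(* The intersection of all maximal submodules of N (N itself if there are none). *)
Definition rad N : set M :=
  [set x | N x /\ forall L, maximal_submodule L N -> L x].

(* [s] lists the terms after L of a chain from L up to N with simple factors. *)
Fixpoint composition_chain L N (s : seq (set M)) : Prop :=
  if s is L' :: s' then maximal_submodule L L' /\ composition_chain L' N s'
  else L = N.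

Definition composition_series N (s : seq (set M)) : Prop :=
  composition_chain [set 0] N s.

Definition uniserial N : Prop :=
  submodule N /\ exists! s, composition_series N s.

Definition submodule_iso L N : Prop :=
  exists2 f : M -> M,
    forall (a : R) x y, L x -> L y -> f (a *: x + y) = a *: f x + f y
    & set_bij L N f.

Definition biserial N : Prop :=
  submodule N /\
  exists U1 U2 : set M,
    [/\ uniserial U1 /\ U1 `<=` N, uniserial U2 /\ U2 `<=` N,
        submodule_iso (rad N) [set x + y | x in U1 & y in U2]
      & simple_module (U1 `&` U2) \/ U1 `&` U2 = [set 0]].

Definition projective : Prop :=
  forall (B C : lmodType R) (g : {linear B -> C}) (f : {linear M -> C}),
    (forall c, exists b, g b = c) ->
    exists h : {linear M -> B}, forall x, g (h x) = f x.

Definition indecomposable : Prop :=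
  [set: M] <> [set 0] /\
  forall X Y : set M, submodule X -> submodule Y ->
    [set x + y | x in X & y in Y] = [set: M] -> X `&` Y = [set 0] ->
    X = [set 0] \/ Y = [set 0].

End Submodules.

(* Right R-modules are left modules over the converse ring R^c. *)
Definition biserial_algebra (R : pzRingType) : Prop :=
  (forall P : lmodType R,
     projective P -> indecomposable P -> biserial [set: P]) /\
  (forall P : lmodType R^c,
     projective P -> indecomposable P -> biserial [set: P]).

(* [eta], [lambda1] and [lambda2] are only meaningful on crease vertices. *)
Record folded_data (K : fieldType) := FoldedData {
  fquiver : quiver;
  crease : {set vertex fquiver};
  eta : vertex fquiver -> arrow fquiver;
  rel1 : set (qpath fquiver);
  lambda1 : vertex fquiver -> K;
  lambda2 : vertex fquiver -> K }.

Arguments rel1 {K} f _.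
Arguments eta {K} f _.
Arguments lambda1 {K} f _.
Arguments lambda2 {K} f _.

Section FoldedGentle.
Variables (K : fieldType) (T : folded_data K).
Local Notation Q := (fquiver T).

Definition crease_loop (a : arrow Q) : bool :=
  [exists v, (v \in crease T) && (a == eta T v)].

Definition ordinary (a : arrow Q) : bool := ~~ crease_loop a.

Definition pair_in (a b : arrow Q) : Prop :=
  exists2 p : qpath Q, arrows p = [:: a; b] & rel1 T p.
(* The concatenation of a and b is a path that does not belong to [rel1 T];
   this fails when a and b are not composable. *)
Definition pair_notin (a b : arrow Q) : Prop :=
  exists2 p : qpath Q, arrows p = [:: a; b] & ~ rel1 T p.

Record folded_gentle : Prop := FoldedGentle {
  eta_loop : forall v, v \in crease T ->
    src (eta T v) = v /\ tgt (eta T v) = v;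
  rel1_ordinary : forall p, rel1 T p ->
    (2 <= size (arrows p))%N /\ all ordinary (arrows p);
  FG1 : forall v : vertex Q,
    (#|[pred a : arrow Q | src a == v]| <= 2)%N /\
    (#|[pred a : arrow Q | tgt a == v]| <= 2)%N;
  FG2 : forall b, ordinary b ->
    (forall a a', pair_notin a b -> pair_notin a' b -> a = a') /\
    (forall c c', pair_notin b c -> pair_notin b c' -> c = c');
  FG3 : forall b, ordinary b ->
    (forall a a', pair_in a b -> pair_in a' b -> a = a') /\
    (forall c c', pair_in b c -> pair_in b c' -> c = c');
  FG4 : forall p, rel1 T p -> size (arrows p) = 2;
  FG5 : forall v, v \in crease T ->
    irreducible_poly ('X^2 - (lambda1 T v)%:P * 'X - (lambda2 T v)%:P) }.

Definition crease_relation (v : vertex Q) : path_algebra K Q :=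
  parr K (eta T v) ^+ 2 - lambda1 T v *: parr K (eta T v)
  - lambda2 T v *: peps K v.

Definition relations : set (path_algebra K Q) :=
  [set pelt K p | p in rel1 T] `|`
  [set crease_relation v | v in [set v | v \in crease T]].

Definition folded_algebra : Type := quot_algebra relations.
HB.instance Definition _ := GRing.PzRing.on folded_algebra.
HB.instance Definition _ := GRing.Lmodule.on folded_algebra.

Definition idem (v : vertex Q) : folded_algebra := qproj relations (peps K v).

End FoldedGentle.

(* Main.v *)
Require Import Defs.
From HB Require Import structures.
From mathcomp Require Import all_boot all_order all_algebra.
From mathcomp Require Import finmap.
From mathcomp Require Import boolp classical_sets functions.
From mathcomp Require Import monalg.
From mathcomp Require Import ring.

Set Implicit Arguments.
Unset Strict Implicit.
Unset Printing Implicit Defensive.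

Import GRing.Theory.
Local Open Scope classical_set_scope.
Local Open Scope ring_scope.

(** Why the theorem holds.  Write [R] for the algebra [A] or its converse, so
    that only left modules are considered, and let [m = vtx v *: m].

    Consider an ordinary arrow [b] and a nonzero [x] in [bM].  To the left of [b]
    there is only one way to go on.  If the source [u] of [b] is an ordinary vertex,
    at most one arrow [a] has [a b <> 0].  If [u] is a crease vertex, every
    ordinary [a] has [a b = 0], because the loop already continues [b];
    but [a eta b] may be nonzero for the unique ordinary arrow [a] into [u].
    So [R x] is [D x + R x1], where [x1] is [a x] or [a eta x] and [D] is
    the field [K], or the quadratic extension [K[eta]] at a crease vertex, where
    the crease polynomial is irreducible.  Ordinary arrows
    act nilpotently, so iterating gives [x], [x1], [x2], ... ending in [0];
    the submodules of [R x] are the [R xi], and [R x] is uniserial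
    ([sub_cyc_left_path], [in_arr_uniserial]).

    The radical of [R m] is [R x + R y] with [x] and [y] of this kind: the products
    of [m] with the two arrows that end at [v], or [a m] and [a eta m] when [v]
    is a crease vertex ([rad_cyc]).  Both summands are uniserial, but their
    intersection [R xi = R yj] may be too big.  If it is not simple, then
    the arrows at [xi] and [yj] are equal and [yj = c xi + (lower terms)] with
    [c] in [K] ([same_cyc]).  Arrows have at most one continuation to the
    right as well, so for [i <= j] the path from [x] to [xi] is also the end of
    the path from [y] to [yj], and [c x - y(j-i)] can replace [x] without
    changing the sum ([arm_shorten]).  This shortens the first chain, so the process
    stops with a simple or zero intersection ([two_arms]).

    An indecomposable projective module is [R m] for some such [m], without any
    finiteness assumption: a coordinate of a splitting into a free module is
    invertible at a vertex and splits off a cyclic summand ([projective_cyclic]).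

    Nilpotency comes from the grading of the path algebra by the number of ordinary
    arrows, for which the relations are homogeneous: nonzero paths of distinct
    degrees are independent in [A], so finite dimension bounds the degree
    ([deg_bound]). *)

(** * Submodules and uniserial modules *)

Section SubmoduleTheory.
Variables (R : pzRingType) (M : lmodType R).
Implicit Types (X Y N : set M) (x y z : M).

Lemma submoduleZ X a x : submodule X -> X x -> X (a *: x).
Proof. by move=> [X0 XD] Xx; rewrite -[_ *: _]addr0; apply: XD. Qed.

Lemma submoduleD X x y : submodule X -> X x -> X y -> X (x + y).
Proof. by move=> [X0 XD] Xx Xy; rewrite -[x]scale1r; apply: XD. Qed.

Lemma submoduleB X x y : submodule X -> X x -> X y -> X (x - y).
Proof.
by move=> sX Xx Xy; rewrite -scaleN1r; apply: submoduleD => //; apply: submoduleZ.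
Qed.

Lemma submodule0 X : submodule X -> X 0. Proof. by case. Qed.

Lemma submodule_set0 : submodule [set 0 : M].
Proof. by split=> // a x y -> ->; rewrite scaler0 addr0. Qed.

Lemma submoduleI X Y : submodule X -> submodule Y -> submodule (X `&` Y).
Proof.
move=> [X0 XD] [Y0 YD]; split=> // a x y [Xx Yx] [Xy Yy].
by split; [apply: XD|apply: YD].
Qed.

Definition sum_set X Y : set M := [set x + y | x in X & y in Y].

Lemma submodule_sum X Y : submodule X -> submodule Y -> submodule (sum_set X Y).
Proof.
move=> [X0 XD] [Y0 YD]; split.
  by exists 0 => //; exists 0 => //; rewrite addr0.
move=> a _ _ [x Xx [y Yy <-]] [x' Xx' [y' Yy' <-]].
exists (a *: x + x'); first exact: XD.
exists (a *: y + y'); first exact: YD.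
by rewrite scalerDr addrACA.
Qed.

Lemma sum_setC X Y : sum_set X Y = sum_set Y X.
Proof.
by apply/seteqP; split=> _ [x Xx [y Yy <-]]; exists y => //; exists x;
  rewrite // addrC.
Qed.

Lemma sub_sum_setl X Y : submodule Y -> X `<=` sum_set X Y.
Proof. by move=> [Y0 _] x Xx; exists x => //; exists 0; rewrite ?addr0. Qed.

Lemma sub_sum_setr X Y : submodule X -> Y `<=` sum_set X Y.
Proof. by rewrite sum_setC; apply: sub_sum_setl. Qed.

Lemma sum_set_sub X Y N :
  submodule N -> X `<=` N -> Y `<=` N -> sum_set X Y `<=` N.
Proof.
by move=> sN XN YN _ [x Xx [y Yy <-]]; apply: submoduleD => //; [apply: XN|apply: YN].
Qed.

Definition cyc (m : M) : set M := [set a *: m | a in [set: R]].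

Lemma cycP m z : cyc m z <-> exists a, z = a *: m.
Proof. by split=> [[a _ <-]|[a ->]]; exists a. Qed.

Lemma cycZ a m : cyc m (a *: m). Proof. by exists a. Qed.

Lemma cyc_id m : cyc m m. Proof. by exists 1; rewrite ?scale1r. Qed.

Lemma submodule_cyc m : submodule (cyc m).
Proof.
split; first by exists 0; rewrite ?scale0r.
by move=> a _ _ [b _ <-] [c _ <-]; exists (a * b + c); rewrite // scalerDl scalerA.
Qed.

Lemma cyc_sub X m : submodule X -> X m -> cyc m `<=` X.
Proof. by move=> sX Xm _ [a _ <-]; apply: submoduleZ. Qed.

Lemma cyc0 : cyc 0 = [set 0].
Proof.
apply/seteqP; split=> [_ [a _ <-]|_ ->]; first by rewrite /= scaler0.
exact: cyc_id.
Qed.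

Lemma cyclic_submoduleE m : cyclic_submodule m = cyc m.
Proof.
apply/seteqP; split; first by move=> z; apply; split=> //; apply: submodule_cyc.
by move=> _ [a _ <-] X [_]; apply; exists a.
Qed.

Lemma submodule_iso_refl X : submodule_iso X X.
Proof. by exists id => //; split=> // x Xx; exists x. Qed.

Lemma composition_chain_sub X N s :
  composition_chain X N s -> X `<=` N.
Proof.
elim: s X => [X ->//|Y s IH X [[_ _ XY _ _] /IH]]; exact: subset_trans.
Qed.

Section FiniteChain.
Variables (N : nat -> set M) (l : nat).
Hypotheses (subN : forall i, submodule (N i))
  (N_decr : forall i, N i.+1 `<=` N i)
  (N_strict : forall i, (i < l)%N -> N i.+1 <> N i)
  (N_l : N l = [set 0])
  (N_all : forall X, submodule X -> X `<=` N 0 -> exists2 i, (i <= l)%N & X = N i).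

Let N_anti i j : (i <= j)%N -> N j `<=` N i.
Proof.
move=> /subnK <-; elim: (j - i)%N => // k IH; exact: subset_trans (@N_decr _) IH.
Qed.

Let N_inj i j : (i < j <= l)%N -> N j <> N i.
Proof.
move=> /andP[ij jl] e; apply: (@N_strict i) (leq_trans ij jl) _.
by apply/seteqP; split=> //; rewrite -e; apply: N_anti.
Qed.

Let N_maximal i : (i < l)%N -> maximal_submodule (N i.+1) (N i).
Proof.
move=> il; split=> //; first exact: N_strict.
move=> X sX iX Xi; have [j jl Xj] := N_all sX (subset_trans Xi (N_anti (leq0n i))).
have [ij|ji] := leqP i.+1 j.
  by left; apply/seteqP; split=> //; rewrite Xj; apply: N_anti.
by right; apply/seteqP; split=> //; rewrite Xj; apply: N_anti.
Qed.

Fixpoint chain_series i : seq (set M) :=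
  if i is j.+1 then N j :: chain_series j else [::].

Let chain_seriesP i s : (i <= l)%N ->
  composition_chain (N i) (N 0) s <-> s = chain_series i.
Proof.
elim: i s => [|i IH] [|L s] il /=; split=> //.
- case=> -[_ _ NL neq _] /composition_chain_sub LN.
  by case: neq; apply/seteqP.
- by move=> e; have := @N_inj 0 i.+1; rewrite il e; case.
- case=> -[_ sL NL neq max] LN.
  have L0 := composition_chain_sub LN; have [j jl Lj] := N_all sL L0.
  have ji : (j <= i)%N.
    by rewrite leqNgt; apply/negP => ij; apply: neq; apply/seteqP; split=> //;
      rewrite Lj; apply: N_anti.
  have eL : N i = L.
    have [| |e|//] := max _ (subN i); first exact: N_decr.
      by rewrite Lj; apply: N_anti.
    by have := @N_inj i i.+1; rewrite leqnn il e; case.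
  by rewrite eL; congr (_ :: _); apply/(IH _ (ltnW il)); rewrite eL.
- case=> -> ->; split; first exact: N_maximal.
  exact/(IH _ (ltnW il)).
Qed.

(** Each submodule is one of the [N i], so a composition series climbing from
    a term [N i.+1] must continue with [N i]. *)
Lemma finite_chain_uniserial : uniserial (N 0).
Proof.
split=> //; exists (chain_series l); rewrite /composition_series -N_l.
by split=> [|s /chain_seriesP ->//]; apply/chain_seriesP.
Qed.

End FiniteChain.

Lemma uniserial0 : uniserial [set 0 : M].
Proof.
apply: (@finite_chain_uniserial (fun=> [set 0]) 0) => // [i|i x //|X sX X0].
  exact: submodule_set0.
exists 0%N => //; apply/seteqP; split=> // _ ->; exact: submodule0.
Qed.

End SubmoduleTheory.

(** * A self-dual abstraction of folded gentle algebras *)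

(** What the argument needs from a folded gentle algebra, in a form that passes to
    the converse ring, so that left and right modules are treated at once.  The
    arrows [E] are the ordinary ones.  [vloop u] is the loop at a crease vertex [u]
    and [0] elsewhere, which avoids most case distinctions, and [norm_eq0] says that
    the norm form of its quadratic polynomial is anisotropic.  [filt n] is to be thought
    of as the [n]-th power of the ideal of ordinary arrows; [filt_nil] is its nilpotency. *)
Record folded_ring (K : fieldType) (R : pzRingType) (V E : finType) := FoldedRing {
  cst : K -> R;
  vtx : V -> R;
  arr : E -> R;
  vloop : V -> R;
  asrc : E -> V;
  atgt : E -> V;
  creases : {set V};
  lam1 : V -> K;
  lam2 : V -> K;
  filt : nat -> set R;
  cstD : forall c d, cst (c + d) = cst c + cst d;
  cstM : forall c d, cst (c * d) = cst c * cst d;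
  cst1 : cst 1 = 1;
  cstC : forall c r, cst c * r = r * cst c;
  vtxM : forall u v, vtx u * vtx v = if u == v then vtx u else 0;
  vtx_sum : \sum_v vtx v = 1;
  arr_src : forall b, vtx (asrc b) * arr b = arr b;
  arr_tgt : forall b, arr b * vtx (atgt b) = arr b;
  vloop_vtxl : forall u, vtx u * vloop u = vloop u;
  vloop_vtxr : forall u, vloop u * vtx u = vloop u;
  vloop0 : forall u, u \notin creases -> vloop u = 0;
  vloop_sqr : forall u, u \in creases ->
    vloop u * vloop u = cst (lam1 u) * vloop u + cst (lam2 u) * vtx u;
  norm_eq0 : forall u c d, u \in creases ->
    c * c + lam1 u * c * d - lam2 u * d * d = 0 -> d = 0;
  ring_gen : forall P : R -> Prop,
    (forall c, P (cst c)) -> (forall v, P (vtx v)) -> (forall b, P (arr b)) ->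
    (forall v, P (vloop v)) -> (forall x y, P x -> P y -> P (x + y)) ->
    (forall x y, P x -> P y -> P (x * y)) -> forall r, P r;
  src_le2 : forall a b c, asrc a = asrc b -> asrc a = asrc c ->
    [\/ a = b, a = c | b = c];
  tgt_le2 : forall a b c, atgt a = atgt b -> atgt a = atgt c ->
    [\/ a = b, a = c | b = c];
  crease_src : forall a b, asrc a \in creases -> asrc a = asrc b -> a = b;
  crease_tgt : forall a b, atgt a \in creases -> atgt a = atgt b -> a = b;
  crease_arr : forall a b, atgt a = asrc b -> atgt a \in creases -> arr a * arr b = 0;
  arr_uniql : forall a a' b, arr a * arr b <> 0 -> arr a' * arr b <> 0 -> a = a';
  arr_uniqr : forall a b b', arr a * arr b <> 0 -> arr a * arr b' <> 0 -> b = b';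
  filt_all : forall r, filt 0 r;
  filt0 : forall n, filt n 0;
  filtD : forall n x y, filt n x -> filt n y -> filt n (x + y);
  filtM : forall m n x y, filt m x -> filt n y -> filt (m + n) (x * y);
  filt_arr : forall b, filt 1 (arr b);
  filt_nil : exists n, forall r, filt n r -> r = 0 }.

Section Converse.
Variables (K : fieldType) (R : pzRingType) (V E : finType).
Variable F : folded_ring K R V E.

Definition converse_folded_ring : folded_ring K R^c V E.
Proof.
refine (@FoldedRing K R^c V E (cst F) (vtx F) (arr F) (vloop F) (atgt F) (asrc F)
  (creases F) (lam1 F) (lam2 F) (filt F) (cstD F) _ (cst1 F) _ _ (vtx_sum F)
  (arr_tgt F) (arr_src F) (vloop_vtxr F) (vloop_vtxl F) (@vloop0 _ _ _ _ F) _
  (@norm_eq0 _ _ _ _ F) _ (@tgt_le2 _ _ _ _ F) (@src_le2 _ _ _ _ F)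
  (@crease_tgt _ _ _ _ F) (@crease_src _ _ _ _ F) _ _ _ (filt_all F) (filt0 F) (@filtD _ _ _ _ F)
  _ (filt_arr F) (filt_nil F)).
- by move=> c d; rewrite mulrC; apply: (cstM F).
- by move=> c r; apply: esym; apply: (cstC F).
- by move=> u v; apply: etrans (vtxM F v u) _; case: eqVneq => [->|vu]; rewrite ?eqxx //;
    rewrite eq_sym (negPf vu).
- by move=> u uC; apply: etrans (vloop_sqr uC) _; congr (_ + _); apply: (cstC F).
- move=> P Ps Pv Pa Pl PD PM; apply: (ring_gen (f := F)) => // x y Px Py; exact: PM.
- by move=> a b e af; apply: (crease_arr (f := F)); rewrite -e.
- by move=> a a' b; apply: (arr_uniqr (f := F)).
- by move=> a b b'; apply: (arr_uniql (f := F)).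
- by move=> m n x y Fx Fy; rewrite addnC; apply: (filtM Fy Fx).
Defined.

End Converse.

(** * Chains of arrows and uniserial modules *)

Section FoldedRingModules.
Variables (K : fieldType) (R : pzRingType) (V E : finType).
Variable F : folded_ring K R V E.
Local Notation cst := (cst F).
Local Notation vtx := (vtx F).
Local Notation arr := (arr F).
Local Notation vloop := (vloop F).
Local Notation asrc := (asrc F).
Local Notation atgt := (atgt F).
Local Notation creases := (creases F).
Local Notation filt := (filt F).
Implicit Types (u v : V) (a b : E) (r : R).

Lemma cst0 : cst 0 = 0.
Proof. by apply: (addrI (cst 0)); rewrite -(cstD F) !addr0. Qed.

(** Generation in [folded_ring] is symmetric; multiplying on the left by
    one generator at a time is enough. *)
Lemma ring_left_ind (P : R -> Prop) :
  P 1 -> (forall x y, P x -> P y -> P (x + y)) ->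
  (forall c x, P x -> P (cst c * x)) -> (forall v x, P x -> P (vtx v * x)) ->
  (forall b x, P x -> P (arr b * x)) -> (forall v x, P x -> P (vloop v * x)) ->
  forall r, P r.
Proof.
move=> P1 PD Ps Pv Pa Pl r.
suff /(_ _ P1) : forall x, P x -> P (r * x) by rewrite mulr1.
move: r; apply: (@ring_gen _ _ _ _ F (fun r => forall x, P x -> P (r * x))) => // [x y Hx Hy z Pz|x y Hx Hy z Pz].
  by rewrite mulrDl; apply: PD; [apply: Hx|apply: Hy].
by rewrite -mulrA; apply: Hx; apply: Hy.
Qed.

Lemma vtx_id u : vtx u * vtx u = vtx u. Proof. by rewrite (vtxM F) eqxx. Qed.

Lemma vtx_ort u v : u <> v -> vtx u * vtx v = 0.
Proof. by move=> /eqP/negPf uv; rewrite (vtxM F) uv. Qed.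

Lemma arr_vtx0 u b : atgt b <> u -> arr b * vtx u = 0.
Proof. by move=> ub; rewrite -(arr_tgt F b) -mulrA vtx_ort // mulr0. Qed.

Lemma arr_arr0 a b : atgt a <> asrc b -> arr a * arr b = 0.
Proof. by move=> ab; rewrite -(arr_src F b) mulrA arr_vtx0 // mul0r. Qed.

Lemma arr_vloop0 b u : atgt b <> u -> arr b * vloop u = 0.
Proof. by move=> bu; rewrite -(vloop_vtxl F u) mulrA arr_vtx0 // mul0r. Qed.

Lemma filtMl n x y : filt n x -> filt n (x * y).
Proof. by move=> Fx; rewrite -[n]addn0; apply: filtM => //; exact: filt_all. Qed.

Lemma filtMr n x y : filt n y -> filt n (x * y).
Proof. by move=> Fy; rewrite -[n]add0n; apply: filtM => //; exact: filt_all. Qed.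

Lemma filtN n x : filt n x -> filt n (- x).
Proof. by move=> Fx; rewrite -mulN1r; apply: filtMr. Qed.

Lemma filtB n x y : filt n x -> filt n y -> filt n (x - y).
Proof. by move=> Fx Fy; apply: (filtD Fx); apply: filtN. Qed.

Lemma filt_exp r n : filt 1 r -> filt n (r ^+ n).
Proof.
move=> Fr; elim: n => [|n IH]; first exact: filt_all.
by rewrite exprS -add1n; apply: filtM.
Qed.

(** The field of scalars at [u]: the quadratic extension [K[eta]] at a crease
    vertex, and [K] elsewhere since [vloop u = 0] there. *)
Definition fscal u c d : R := cst c + cst d * vloop u.

Lemma fscal_vtx u c d : fscal u c d * vtx u = vtx u * fscal u c d.
Proof.
rewrite /fscal mulrDl mulrDr (cstC F); congr (_ + _).
by rewrite -mulrA (vloop_vtxr F) mulrA -(cstC F) -mulrA (vloop_vtxl F).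
Qed.

Lemma fscalM u c' d' c d : u \in creases ->
  fscal u c' d' * fscal u c d * vtx u =
  fscal u (c' * c + d' * d * lam2 F u) (c' * d + d' * c + d' * d * lam1 F u) * vtx u.
Proof.
move=> uC; have e1 : cst c' * (cst d * vloop u) = cst (c' * d) * vloop u.
  by rewrite mulrA -(cstM F).
have e2 : cst d' * vloop u * cst c = cst (d' * c) * vloop u.
  by rewrite -mulrA -(cstC F) mulrA -(cstM F).
have e3 : cst d' * vloop u * (cst d * vloop u) =
    cst (d' * d * lam1 F u) * vloop u + cst (d' * d * lam2 F u) * vtx u.
  by rewrite -mulrA (mulrA (vloop u)) -(cstC F) -mulrA vloop_sqr // !mulrDr !mulrA -!(cstM F).
rewrite /fscal mulrDl !mulrDr -(cstM F) e1 e2 e3 !(cstD F) !mulrDl.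
rewrite -(mulrA _ (vtx u) (vtx u)) vtx_id -!addrA; congr (_ + _).
by rewrite [RHS]addrC -!addrA.
Qed.

(** A nonzero [c + d eta] times its conjugate [c + lam1 d - d eta] is the norm
    [c^2 + lam1 c d - lam2 d^2], which vanishes only at [0]. *)
Lemma fscal_inv u c d : fscal u c d * vtx u <> 0 ->
  exists c' d', fscal u c' d' * fscal u c d * vtx u = vtx u.
Proof.
have [uC|uC] := boolP (u \in creases); last first.
  rewrite /fscal (vloop0 uC) mulr0 addr0 => nz.
  have c0 : c != 0 by apply/eqP => c0; rewrite c0 cst0 mul0r in nz.
  exists c^-1, 0; rewrite mulr0 addr0 -(cstM F) mulVf // (cst1 F) mul1r //.
move=> nz; pose t := lam1 F u; pose n := lam2 F u.
pose N := c * c + t * c * d - n * d * d.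
have N0 : N != 0.
  apply/eqP => N0; have d0 := norm_eq0 uC N0; case: nz.
  move: N0; rewrite /N d0 !mulr0 subr0 addr0 => /eqP; rewrite mulf_eq0 orbb => /eqP ->.
  by rewrite /fscal cst0 mul0r addr0 mul0r.
exists ((c + t * d) / N), (- d / N); rewrite fscalM // -/t -/n.
set p := _ / N; set q := _ / N.
have -> : p * c + q * d * n = 1.
  by rewrite /p /q /N; field; move: N0; rewrite /N.
have -> : p * d + q * c + q * d * t = 0.
  by rewrite /p /q /N; field; move: N0; rewrite /N.
by rewrite /fscal cst0 mul0r addr0 (cst1 F) mul1r.
Qed.

(** At a crease vertex [a b] is zero and it is [a eta b] that continues [b], so the
    endpoints alone decide. *)
Definition link a b : Prop :=
  atgt a = asrc b /\ (asrc b \in creases \/ arr a * arr b <> 0).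

(** Each arrow has at most one neighbour on either side: at an ordinary vertex
    this is the gentle condition, at a crease vertex the loop leaves room for only one
    ordinary arrow in and one out. *)
Lemma link_uniql a a' b : link a b -> link a' b -> a = a'.
Proof.
move=> [e [bC|ab]] [e' [bC'|ab']]; last exact: arr_uniql ab ab'.
- by apply: (crease_tgt (f := F)); rewrite e ?e'.
- by apply: (crease_tgt (f := F)); rewrite e ?e'.
- by apply: (crease_tgt (f := F)); rewrite e ?e'.
Qed.

Lemma link_uniqr a b b' : link a b -> link a b' -> b = b'.
Proof.
move=> [e [bC|ab]] [e' [bC'|ab']]; last exact: arr_uniqr ab ab'.
- by apply: (crease_src (f := F)); rewrite -e ?e' // -e' e.
- by apply: (crease_src (f := F)); rewrite -e ?e' // -e' e.
- by apply: (crease_src (f := F)); rewrite -e ?e' // -e' e.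
Qed.

Definition left_ext b : option E := [pick a | `[< link a b >]].

(** Total, like [left_step], which is [0] at an arrow without left neighbour: every
    chain then goes on with zeros and needs no length of its own. *)
Definition left_next b : E := odflt b (left_ext b).

Definition left_step b : R :=
  if left_ext b is Some a then if asrc b \in creases then arr a * vloop (asrc b) else arr a
  else 0.

Lemma link_left_ext a b : link a b -> left_ext b = Some a.
Proof.
move=> l; rewrite /left_ext; case: pickP => [a' /asboolP l'|/(_ a)/asboolP//].
by rewrite (link_uniql l l').
Qed.

Lemma left_ext_link a b : left_ext b = Some a -> link a b.
Proof. by rewrite /left_ext; case: pickP => // a' /asboolP l [<-]. Qed.

Lemma left_step_link b : left_step b <> 0 -> link (left_next b) b.
Proof. by rewrite /left_step /left_next; case e: (left_ext b) => [a|//] _; apply: left_ext_link. Qed.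

Lemma filt_left_step b : filt 1 (left_step b).
Proof.
rewrite /left_step; case: (left_ext b) => [a|]; last exact: filt0.
by case: ifP => _; [apply: filtMl|]; apply: filt_arr.
Qed.

Lemma left_step_arr b : exists r, left_step b = arr (left_next b) * r.
Proof.
rewrite /left_step /left_next; case: (left_ext b) => [a|] /=; last by exists 0; rewrite mulr0.
by case: ifP => _; [exists (vloop (asrc b))|exists 1; rewrite mulr1].
Qed.

(** Together with the next lemma: whatever is obtained from [b] by one more
    ordinary arrow, with or without a loop before it, is already a multiple
    of the step to the left. *)
Lemma arr_left_step a b : exists r, arr a * arr b = r * left_step b * arr b.
Proof.
case: (pselect (arr a * arr b = 0)) => [->|ab]; first by exists 0; rewrite !mul0r.
have e : atgt a = asrc b by apply: contrapT => /arr_arr0.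
have bC : asrc b \notin creases by apply/negP => bC; apply: ab; apply: crease_arr; rewrite ?e.
exists 1; rewrite mul1r /left_step (@link_left_ext a b) ?(negPf bC) //.
by split=> //; right.
Qed.

Lemma arr_vloop_left_step a b : exists r, arr a * vloop (asrc b) * arr b = r * left_step b * arr b.
Proof.
have [bC|bC] := boolP (asrc b \in creases); last first.
  by exists 0; rewrite (vloop0 bC) mulr0 !mul0r.
have [e|/eqP e] := eqVneq (atgt a) (asrc b); last first.
  by exists 0; rewrite arr_vloop0 // !mul0r.
exists 1; rewrite mul1r /left_step (@link_left_ext a b) ?bC //; by split=> //; left.
Qed.

Fixpoint left_path b i : R := if i is j.+1 then left_path (left_next b) j * left_step b else 1.

Lemma left_pathD b i j : left_path b (i + j) = left_path (iter i left_next b) j * left_path b i.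
Proof.
elim: i b => [|i IH] b; first by rewrite /= mulr1.
by rewrite addSn -/iter iterSr /= IH mulrA.
Qed.

Lemma left_pathSr b i : left_path b i.+1 = left_step (iter i left_next b) * left_path b i.
Proof. by rewrite -addn1 left_pathD /= mul1r. Qed.

Lemma filt_left_path b i : filt i (left_path b i).
Proof.
elim: i => [|i IH]; first exact: filt_all.
by rewrite left_pathSr -add1n; apply: filtM => //; apply: filt_left_step.
Qed.

Section Modules.
Variable M : lmodType R.
Implicit Types (x y z m : M) (X : set M).

Lemma filt1_fix r x : filt 1 r -> r *: x = x -> x = 0.
Proof.
move=> Fr rx; have [n Fn] := filt_nil F.
have -> : x = r ^+ n *: x by elim: n {Fn} => [|n IH]; rewrite ?scale1r // exprSr -scalerA rx.
by rewrite (Fn _ (filt_exp n Fr)) scale0r.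
Qed.

(** Nakayama's lemma for cyclic modules: substitute the equation into itself
    until the power of [r] vanishes. *)
Lemma filt1_nakayama s r x z : filt 1 r -> x = s *: z + r *: x -> cyc z x.
Proof.
move=> Fr xe; have [n Fn] := filt_nil F.
suff [s' ->] : exists s', x = s' *: z + r ^+ n *: x.
  by rewrite (Fn _ (filt_exp n Fr)) scale0r addr0; apply: cycZ.
elim: n {Fn} => [|n [s' IH]]; first by exists 0; rewrite scale0r add0r scale1r.
exists (s' + r ^+ n * s).
by rewrite {1}IH {1}xe scalerDr !scalerA exprSr addrA scalerDl.
Qed.

Lemma cst_nongen c r x : c <> 0 -> filt 1 r -> cst c *: x = r *: x -> x = 0.
Proof.
move=> /eqP c0 Fr e; apply: (@filt1_fix (cst c^-1 * r)); first exact: filtMr.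
by rewrite -scalerA -e scalerA -(cstM F) mulVf // (cst1 F) scale1r.
Qed.

Lemma fscal_scale u c d z : vtx u *: z = z ->
  vtx u *: (fscal u c d *: z) = fscal u c d *: z.
Proof. by move=> uz; rewrite scalerA -fscal_vtx -scalerA uz. Qed.

Lemma fscal_scale_inv u c d z : vtx u *: z = z -> fscal u c d *: z <> 0 ->
  exists c' d', fscal u c' d' *: (fscal u c d *: z) = z.
Proof.
move=> uz nz; have [|c' [d' e]] := @fscal_inv u c d.
  by move=> k0; apply: nz; rewrite -uz scalerA k0 scale0r.
by exists c', d'; rewrite -[in LHS]uz !scalerA e.
Qed.

(** If [X] contains everything that an ordinary arrow makes of [z], with or without
    the loop in between, then [z] has only its multiples by the field at [u] left modulo
    [X], and these form a simple or zero module. *)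
Lemma vtx_decomp u z X : vtx u *: z = z -> submodule X ->
  (forall b, X (arr b *: z)) -> (forall b, X ((arr b * vloop u) *: z)) ->
  forall r, exists c d, X (r *: z - fscal u c d *: z).
Proof.
move=> uz sX Xa Xl; have X0 := submodule0 sX.
apply: ring_left_ind => [|x y [c [d H]] [c' [d' H']]|c' x [c [d H]]|v x [c [d H]]
  |b x [c [d H]]|v x [c [d H]]].
- exists 1, 0; rewrite /fscal (cst1 F) cst0 mul0r addr0 subrr //.
- exists (c + c'), (d + d').
  have -> : fscal u (c + c') (d + d') = fscal u c d + fscal u c' d'.
    by rewrite /fscal !(cstD F) mulrDl addrACA.
  by rewrite (scalerDl z x) (scalerDl z (fscal u c d)) opprD addrACA; apply: submoduleD.
- exists (c' * c), (c' * d).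
  have -> : fscal u (c' * c) (c' * d) = cst c' * fscal u c d.
    by rewrite /fscal !(cstM F) mulrDr mulrA.
  by rewrite -!scalerA -scalerBr; apply: submoduleZ.
- have [<-|/eqP uv] := eqVneq u v.
    exists c, d; rewrite -(fscal_scale c d uz) -scalerA -scalerBr; exact: submoduleZ.
  exists 0, 0; rewrite /fscal cst0 mul0r addr0 scale0r subr0.
  have k0 : vtx v *: (fscal u c d *: z) = 0.
    by rewrite -(fscal_scale c d uz) scalerA vtx_ort ?scale0r //; apply: nesym.
  rewrite -scalerA -[x *: z](subrK (fscal u c d *: z)) scalerDr k0 addr0.
  exact: submoduleZ.
- exists 0, 0; rewrite /fscal cst0 mul0r addr0 scale0r subr0.
  have Xk : X ((arr b * fscal u c d) *: z).
    rewrite /fscal mulrDr mulrA -!(cstC F) scalerDl -mulrA -!scalerA.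
    by apply: submoduleD => //; apply: submoduleZ => //; rewrite ?scalerA.
  rewrite -[_ *: _](subrK ((arr b * fscal u c d) *: z)); apply: submoduleD => //.
  by rewrite -!scalerA -scalerBr; apply: submoduleZ.
have [<-|/eqP uv] := eqVneq u v; last first.
  exists 0, 0; rewrite /fscal cst0 mul0r addr0 scale0r subr0.
  have k0 : vloop v *: (fscal u c d *: z) = 0.
    rewrite -(fscal_scale c d uz) scalerA -(vloop_vtxr F) -mulrA.
    by rewrite vtx_ort ?mulr0 ?scale0r //; apply: nesym.
  rewrite -scalerA -[x *: z](subrK (fscal u c d *: z)) scalerDr k0 addr0.
  exact: submoduleZ.
suff [c' [d' e]] : exists c' d', vloop u *: (fscal u c d *: z) = fscal u c' d' *: z.
  by exists c', d'; rewrite -e -scalerA -scalerBr; apply: submoduleZ.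
have [uC|uC] := boolP (u \in creases); last first.
  by exists 0, 0; rewrite /fscal (vloop0 uC) cst0 mul0r addr0 !scale0r.
exists (d * lam2 F u), (c + d * lam1 F u).
have -> : vloop u = fscal u 0 1 by rewrite /fscal cst0 (cst1 F) add0r mul1r.
by rewrite -[in LHS]uz -[in RHS]uz !scalerA fscalM // !mul0r !mul1r !add0r.
Qed.

Definition in_arr b x : Prop := exists z, x = arr b *: z.

Lemma in_arr_vtx b x : in_arr b x -> vtx (asrc b) *: x = x.
Proof. by move=> [z ->]; rewrite scalerA (arr_src F). Qed.

Lemma in_arr_cst b c x : in_arr b x -> in_arr b (cst c *: x).
Proof. by move=> [z ->]; exists (cst c *: z); rewrite !scalerA (cstC F). Qed.

Lemma in_arrB b x y : in_arr b x -> in_arr b y -> in_arr b (x - y).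
Proof. by move=> [z ->] [w ->]; exists (z - w); rewrite scalerBr. Qed.

Lemma in_arr_left_step b x : in_arr (left_next b) (left_step b *: x).
Proof. by have [r ->] := left_step_arr b; exists (r *: x); rewrite scalerA. Qed.

Lemma in_arr_left_path b x i : in_arr b x -> in_arr (iter i left_next b) (left_path b i *: x).
Proof.
case: i => [|i] bx; first by rewrite scale1r.
by rewrite left_pathSr -scalerA; apply: in_arr_left_step.
Qed.

Lemma arr_decomp b x r : in_arr b x ->
  exists c d, cyc (left_step b *: x) (r *: x - fscal (asrc b) c d *: x).
Proof.
move=> bx; apply: vtx_decomp; [exact: in_arr_vtx|exact: submodule_cyc| |] => a.
  have [z ->] := bx; have [s e] := arr_left_step a b.
  by rewrite [arr a *: _]scalerA e -!scalerA; apply: cycZ.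
have [z ->] := bx; have [s e] := arr_vloop_left_step a b.
by rewrite [(arr a * _) *: _]scalerA e -!scalerA; apply: cycZ.
Qed.

(** Field scalars are invertible on [x], so a nonzero multiple cannot lie in the
    radical. *)
Lemma fscal_nongen b x c d r : in_arr b x -> filt 1 r ->
  fscal (asrc b) c d *: x = r *: x -> fscal (asrc b) c d *: x = 0.
Proof.
move=> bx Fr e; apply: contrapT => nz.
have [c' [d' e']] := fscal_scale_inv (in_arr_vtx bx) nz.
apply: nz; rewrite (_ : x = 0) ?scaler0 //.
by apply: (@filt1_fix (fscal (asrc b) c' d' * r)); [apply: filtMr|rewrite -scalerA -e].
Qed.

(** [R (left_step b *: x)] is the radical of [R x]. *)
Lemma filt1_arr b x r : in_arr b x -> filt 1 r -> cyc (left_step b *: x) (r *: x).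
Proof.
move=> bx Fr; have [c [d [s _ /esym e]]] := arr_decomp r bx.
have k0 : fscal (asrc b) c d *: x = 0.
  apply: (@fscal_nongen _ _ _ _ (r - s * left_step b)) => //.
    by apply: filtB => //; apply: filtMr; apply: filt_left_step.
  by rewrite scalerBl -scalerA -e opprB addrC subrK.
by exists s => //; rewrite -e k0 subr0.
Qed.

(** Taking radicals is monotone; this compares the lengths of two chains without
    counting composition factors. *)
Lemma cyc_left_step b c w z : in_arr b w -> cyc w z -> cyc (left_step b *: w) (left_step c *: z).
Proof.
move=> bw /cycP[a ->]; rewrite scalerA; apply: filt1_arr => //.
by apply: filtMl; apply: filt_left_step.
Qed.

Lemma cyc_left_path b c w z t : in_arr b w -> cyc w z ->
  cyc (left_path b t *: w) (left_path c t *: z).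
Proof.
elim: t b c w z => [|t IH] b c w z bw wz; first by rewrite !scale1r.
by rewrite /= -!scalerA; apply: IH; [apply: in_arr_left_step|apply: cyc_left_step].
Qed.

(** A submodule of [R x] either lies in the radical [R (left_step b x)], or contains
    an element with a nonzero leading term and is everything. *)
Lemma sub_cyc_left_path b x l X : in_arr b x -> left_path b l *: x = 0 -> submodule X ->
  X `<=` cyc x -> exists2 i, (i <= l)%N & X = cyc (left_path b i *: x).
Proof.
elim: l b x X => [|l IH] b x X bx xl sX Xx.
  exists 0%N => //; rewrite xl cyc0; apply/seteqP; split=> [z /Xx|_ ->].
    by move/cycP=> [a ->]; rewrite -[x]scale1r -[1]/(left_path b 0) xl scaler0.
  exact: submodule0.
case: (pselect (X `<=` cyc (left_step b *: x))) => [Xst|].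
  have [||i il ->] := IH (left_next b) (left_step b *: x) X _ _ sX Xst.
  - exact: in_arr_left_step.
  - by rewrite scalerA.
  by exists i.+1 => //=; rewrite scalerA.
move=> /existsNP[z /not_implyP[Xz zst]].
exists 0%N => //; rewrite scale1r; apply/seteqP; split=> //; apply: cyc_sub => //.
have /cycP[r ze] := Xx _ Xz; have [c [d [s _ /esym e]]] := arr_decomp r bx.
have nz : fscal (asrc b) c d *: x <> 0.
  by move=> k0; apply: zst; move: e; rewrite k0 subr0 -ze => ->; apply: cycZ.
have [c' [d' e']] := fscal_scale_inv (in_arr_vtx bx) nz.
apply: (cyc_sub sX Xz); apply: (@filt1_nakayama (fscal (asrc b) c' d') (- (fscal (asrc b) c' d' * s * left_step b))).
  by apply: filtN; apply: filtMr; apply: filt_left_step.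
by rewrite scaleNr -!scalerA -e scalerBr -ze e' opprB addrC subrK.
Qed.

Lemma left_path_length b x : exists l, left_path b l *: x = 0.
Proof.
by have [n Fn] := filt_nil F; exists n; rewrite (Fn _ (filt_left_path b n)) scale0r.
Qed.

Lemma cyc_left_step_strict b x : in_arr b x -> x <> 0 -> cyc (left_step b *: x) <> cyc x.
Proof.
move=> bx x0 e; have /cycP[r xe] : cyc (left_step b *: x) x by rewrite e; apply: cyc_id.
apply: x0; apply: (@filt1_fix (r * left_step b)); last by rewrite -scalerA.
by apply: filtMr; apply: filt_left_step.
Qed.

Lemma cyc_left_step_sub b x : cyc (left_step b *: x) `<=` cyc x.
Proof. by apply: cyc_sub; [apply: submodule_cyc|apply: cycZ]. Qed.

Lemma in_arr_uniserial b x : in_arr b x -> uniserial (cyc x).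
Proof.
move=> bx; have ex : exists l, `[< left_path b l *: x = 0 >].
  by have [l xl] := left_path_length b x; exists l; apply/asboolP.
case: (ex_minnP ex) => l /asboolP xl min_l.
(* [x] is the term with index [0] of its own chain. *)
rewrite -[x]scale1r -[1]/(left_path b 0).
apply: (@finite_chain_uniserial _ _ (fun i => cyc (left_path b i *: x)) l).
- by move=> i; apply: submodule_cyc.
- by move=> i; rewrite left_pathSr -scalerA; apply: cyc_left_step_sub.
- move=> i il; rewrite left_pathSr -scalerA; apply: cyc_left_step_strict; first exact: in_arr_left_path.
  by move=> xi; have := min_l i; rewrite leqNgt il => /(_ (introT (asboolP _) xi)).
- by rewrite xl cyc0.
- by move=> X sX; rewrite scale1r; apply: sub_cyc_left_path.
Qed.

Lemma in_arr_simple b x : in_arr b x -> x <> 0 -> left_step b *: x = 0 ->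
  simple_module (cyc x).
Proof.
move=> bx x0 x1; split; first exact: submodule_cyc.
  by move=> e; apply: x0; have := cyc_id x; rewrite e.
move=> X sX Xx; have [|[|[|//]] _ ->] := @sub_cyc_left_path b x 1 X bx _ sX Xx.
- by rewrite /= mul1r.
- by right; rewrite scale1r.
- by left; rewrite /= mul1r x1 cyc0.
Qed.

(** Let [a] be the arrow that continues [b].  At an ordinary vertex [a y] has the
    nonzero leading term [c a x], so [a] continues [b'] too and [b = b'].
    At a crease vertex [b = b'] is automatic, and the leading coefficient of [y] could
    be [c + d eta]; but [a y = 0], while [a (c + d eta) x] is [d a eta x], a leading
    term, so [d = 0]. *)
Lemma same_cyc b x b' y : in_arr b x -> in_arr b' y -> cyc x = cyc y ->
  left_step b *: x <> 0 ->
  b = b' /\ exists c r, c <> 0 /\ y = cst c *: x + r *: (left_step b *: x).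
Proof.
move=> bx b'y exy x1.
have x0 : x <> 0 by move=> x0; apply: x1; rewrite x0 scaler0.
have /cycP[r ye] : cyc x y by rewrite exy; apply: cyc_id.
have [c [d [a _ /esym e]]] := arr_decomp r bx.
have {e}ye : y = fscal (asrc b) c d *: x + a *: (left_step b *: x).
  by rewrite -e ye addrC subrK.
have nz : fscal (asrc b) c d *: x <> 0.
  move=> k0; have yst : cyc (left_step b *: x) y by rewrite ye k0 add0r; apply: cycZ.
  apply: (cyc_left_step_strict bx x0); apply/seteqP; split; first exact: cyc_left_step_sub.
  by rewrite exy; apply: cyc_sub => //; apply: submodule_cyc.
have esrc : asrc b = asrc b'.
  apply: contrapT => neq; apply: nz.
  apply: (@fscal_nongen _ _ _ _ (- (vtx (asrc b) * a * left_step b))) => //.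
    by apply: filtN; apply: filtMr; apply: filt_left_step.
  have : vtx (asrc b) *: y = 0 by rewrite -(in_arr_vtx b'y) scalerA vtx_ort // scale0r.
  rewrite {1}ye scalerDr (fscal_scale _ _ (in_arr_vtx bx)) => /eqP; rewrite addr_eq0 => /eqP ->.
  by rewrite scaleNr -!scalerA.
have stb : left_step b <> 0 by move=> s0; apply: x1; rewrite s0 scale0r.
have ln := left_step_link stb; have prevb := link_left_ext ln.
have [uC|uC] := boolP (asrc b \in creases).
  have bb' : b = b' by apply: (crease_src (f := F)).
  split=> //; exists c, a.
  have stE : left_step b = arr (left_next b) * vloop (asrc b) by rewrite /left_step prevb uC.
  have arr0 z : in_arr b z -> arr (left_next b) *: z = 0.
    by move=> [w ->]; rewrite scalerA (crease_arr (f := F)) ?scale0r //; case: ln => // ->.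
  have d0 : d = 0.
    apply: contrapT => d0; apply: x1.
    apply: (@cst_nongen d (- (arr (left_next b) * a))) => //.
      by apply: filtN; apply: filtMl; apply: filt_arr.
    have : arr (left_next b) *: y = 0 by apply: arr0; rewrite bb'.
    rewrite ye scalerDr /fscal scalerDl scalerDr.
    have -> : arr (left_next b) *: (cst c *: x) = 0.
      by rewrite scalerA -(cstC F) -scalerA arr0 // scaler0.
    rewrite add0r scalerA mulrA -(cstC F) -mulrA -stE -scalerA => /eqP.
    by rewrite addr_eq0 => /eqP ->; rewrite scaleNr scalerA.
  move: ye nz; rewrite d0 /fscal cst0 mul0r addr0 => ye nz; split=> // c0.
  by apply: nz; rewrite c0 cst0 scale0r.
have stE : left_step b = arr (left_next b) by rewrite /left_step prevb (negPf uC).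
move: ye nz; rewrite /fscal (vloop0 uC) mulr0 addr0 => ye nz.
have c0 : c <> 0 by move=> c0; apply: nz; rewrite c0 cst0 scale0r.
split; last by exists c, a.
have [_ [bC|lb]] := ln; first by rewrite bC in uC.
apply: (arr_uniqr lb (b' := b')) => lb'; apply: x1.
apply: (@cst_nongen c (- (arr (left_next b) * a))) => //.
  by apply: filtN; apply: filtMl; apply: filt_arr.
have : arr (left_next b) *: y = 0.
  by have [w ->] := b'y; rewrite scalerA lb' scale0r.
rewrite ye scalerDr scalerA -(cstC F) -scalerA stE => /eqP.
by rewrite addr_eq0 => /eqP ->; rewrite scaleNr scalerA.
Qed.

End Modules.
End FoldedRingModules.

(** * Sums of two uniserial modules *)

Section Biserial.
Variables (K : fieldType) (R : pzRingType) (V E : finType).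
Variable F : folded_ring K R V E.
Variable M : lmodType R.
Local Notation cst := (cst F).
Local Notation vtx := (vtx F).
Local Notation arr := (arr F).
Local Notation vloop := (vloop F).
Local Notation asrc := (asrc F).
Local Notation atgt := (atgt F).
Local Notation creases := (creases F).
Local Notation filt := (filt F).
Local Notation left_next := (left_next F).
Local Notation left_step := (left_step F).
Local Notation left_path := (left_path F).
Local Notation in_arr := (in_arr F).
Implicit Types (u v : V) (a b : E) (r : R) (x y z m : M) (X : set M).

(** Links are injective on both sides, so two chains that meet at an arrow agree
    backwards until the shorter one starts. *)
Lemma iter_left_next_cancel i j b b' : (i <= j)%N -> left_path b i <> 0 -> left_path b' j <> 0 ->
  iter i left_next b = iter j left_next b' -> b = iter (j - i) left_next b'.
Proof.
elim: i j => [|i IH] [|j] //= ij; rewrite ?subn0 // => bi b'j e.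
have nz c k : left_path c k.+1 <> 0 -> left_step (iter k left_next c) <> 0 /\ left_path c k <> 0.
  by rewrite left_pathSr => ck; split=> s0; apply: ck; rewrite s0 ?mul0r ?mulr0.
have [si bi'] := nz _ _ bi; have [sj b'j'] := nz _ _ b'j.
rewrite subSS; apply: IH => //; apply: (link_uniqr (left_step_link si)).
by rewrite e; apply: left_step_link.
Qed.

(** The combination [c x - w], with [w] the element of the chain of [y] that is
    [i] steps before the meeting point, cancels the leading term of [xi].
    So its [i]-th descendant lies one step lower than [xi] and its chain is
    shorter than that of [x]. *)
Lemma arm_shorten b x b' y i j l : in_arr b x -> in_arr b' y -> (i <= j)%N ->
  left_path b l *: x = 0 -> cyc (left_path b i *: x) = cyc (left_path b' j *: y) ->
  left_path b i.+1 *: x <> 0 ->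
  exists x', [/\ in_arr b x', left_path b l.-1 *: x' = 0
    & sum_set (cyc x) (cyc y) = sum_set (cyc x') (cyc y)].
Proof.
move=> bx b'y ij xl exy xi1.
have bxi := in_arr_left_path i bx; have b'yj := in_arr_left_path j b'y.
have xi1' : left_step (iter i left_next b) *: (left_path b i *: x) <> 0 by rewrite scalerA -left_pathSr.
have [eb [c [r [c0 ye]]]] := same_cyc bxi b'yj exy xi1'.
have nzx : left_path b i *: x <> 0 by move=> e; apply: xi1'; rewrite e scaler0.
have nzy : left_path b' j *: y <> 0.
  by move=> e; apply: nzx; have := cyc_id (left_path b i *: x); rewrite exy e cyc0.
have bE : b = iter (j - i) left_next b'.
  by apply: iter_left_next_cancel => // e0; [apply: nzx|apply: nzy]; rewrite e0 scale0r.
pose w := left_path b' (j - i) *: y.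
have wi : left_path b i *: w = left_path b' j *: y by rewrite scalerA bE -left_pathD subnK.
have bw : in_arr b w by rewrite bE; apply: in_arr_left_path.
pose x' := cst c *: x - w.
exists x'; split; first by apply: in_arrB => //; apply: in_arr_cst.
  have li : (i < l)%N.
    rewrite ltnNge; apply/negP => li; apply: nzx.
    by rewrite -(subnKC li) left_pathD -scalerA xl scaler0.
  have x'i : cyc (left_step (iter i left_next b) *: (left_path b i *: x)) (left_path b i *: x').
    apply/cycP; exists (- r); rewrite scalerBr wi ye scalerA -(cstC F) -scalerA opprD.
    by rewrite addrA subrr add0r scaleNr.
  have : cyc 0 (left_path (iter i left_next b) (l.-1 - i) *: (left_path b i *: x')).
    rewrite -xl -{1}(subnKC li) addSnnS left_pathD -scalerA.
    have -> : (l - i.+1).+1 = (l.-1 - i).+1 by rewrite -subn1 -subnDA add1n.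
    rewrite [left_path _ _.+1]/= -scalerA; apply: cyc_left_path => //; exact: in_arr_left_step.
  by rewrite cyc0 scalerA -left_pathD subnKC // -ltnS prednK // (leq_trans _ li).
have /eqP c0' := c0; apply/seteqP.
have s1 := submodule_sum (submodule_cyc x) (submodule_cyc y).
have s2 := submodule_sum (submodule_cyc x') (submodule_cyc y).
have yw z : sum_set (cyc z) (cyc y) w.
  by apply: sub_sum_setr; [apply: submodule_cyc|apply: cycZ].
have zz z : sum_set (cyc z) (cyc y) z.
  by apply: sub_sum_setl; [apply: submodule_cyc|apply: cyc_id].
split; apply: sum_set_sub => //; try exact: sub_sum_setr (submodule_cyc _).
  apply: cyc_sub => //.
  have -> : x = cst c^-1 *: (x' + w).
    by rewrite subrK scalerA -(cstM F) mulVf // (cst1 F) scale1r.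
  by apply: submoduleZ => //; apply: submoduleD.
by apply: cyc_sub => //; apply: submoduleB => //; apply: submoduleZ.
Qed.

(** A nonzero intersection that is not simple allows one of the arms to be
    shortened, so induct on the sum of the lengths. *)
Lemma two_arms b x b' y : in_arr b x -> in_arr b' y ->
  exists x' y', [/\ in_arr b x', in_arr b' y',
    sum_set (cyc x) (cyc y) = sum_set (cyc x') (cyc y')
    & simple_module (cyc x' `&` cyc y') \/ cyc x' `&` cyc y' = [set 0]].
Proof.
move=> bx b'y; have [l xl] := left_path_length F b x; have [l' yl'] := left_path_length F b' y.
have [n] := ubnP (l + l'); elim: n => // n IH in x y l l' bx b'y xl yl' *.
rewrite ltnS => ln.
case: (pselect (cyc x `&` cyc y = [set 0])) => [W0|W0]; first by exists x, y; split=> //; right.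
case: (pselect (simple_module (cyc x `&` cyc y))) => [Ws|Ws].
  by exists x, y; split=> //; left.
have sW := submoduleI (submodule_cyc x) (submodule_cyc y).
have [i il Wx] := sub_cyc_left_path bx xl sW (@subIsetl _ _ _).
have [j jl Wy] := sub_cyc_left_path b'y yl' sW (@subIsetr _ _ _).
have nzx : left_path b i *: x <> 0 by move=> e; apply: W0; rewrite Wx e cyc0.
have nzy : left_path b' j *: y <> 0 by move=> e; apply: W0; rewrite Wy e cyc0.
have xi1 : left_path b i.+1 *: x <> 0.
  rewrite left_pathSr -scalerA => e; apply: Ws; rewrite Wx.
  by apply: (in_arr_simple (in_arr_left_path i bx)).
have yj1 : left_path b' j.+1 *: y <> 0.
  rewrite left_pathSr -scalerA => e; apply: Ws; rewrite Wy.
  by apply: (in_arr_simple (in_arr_left_path j b'y)).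
have l0 : (0 < l)%N by case: l xl {il ln} => // xl; case: nzx;
  rewrite -[x]scale1r -[1]/(left_path b 0) xl scaler0.
have l'0 : (0 < l')%N by case: l' yl' {jl ln} => // yl'; case: nzy;
  rewrite -[y]scale1r -[1]/(left_path b' 0) yl' scaler0.
have [ij|/ltnW ji] := leqP i j.
  have [|x' [bx' x'l ->]] := @arm_shorten b x b' y i j l bx b'y ij xl _ xi1.
    by rewrite -Wx.
  apply: (IH _ _ l.-1 l') => //; apply: leq_trans ln.
  by rewrite -addSn prednK.
have [|y' [b'y' y'l e]] := @arm_shorten b' y b x j i l' b'y bx ji yl' _ yj1.
  by rewrite -Wx.
rewrite sum_setC e sum_setC.
apply: (IH _ _ l l'.-1) => //; apply: leq_trans ln.
by rewrite -addnS prednK.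
Qed.

(** Elements of the radical of the ring send [m] into every maximal submodule by
    Nakayama's lemma; conversely the quotient of [R m] by the sum is a line over the field at
    [v], so the sum is itself maximal. *)
Lemma rad_cyc v m x y rx ry : m <> 0 -> vtx v *: m = m ->
  filt 1 rx -> filt 1 ry -> x = rx *: m -> y = ry *: m ->
  (forall b, sum_set (cyc x) (cyc y) (arr b *: m)) ->
  (forall b, sum_set (cyc x) (cyc y) ((arr b * vloop v) *: m)) ->
  Defs.rad (cyc m) = sum_set (cyc x) (cyc y).
Proof.
move=> m0 vm Fx Fy xe ye Xa Xl; set X := sum_set _ _.
have sX : submodule X by apply: submodule_sum; apply: submodule_cyc.
have sm := submodule_cyc m.
have Xm : X `<=` cyc m.
  by apply: sum_set_sub => //; apply: cyc_sub => //; rewrite ?xe ?ye; apply: cycZ.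
have mX : ~ X m.
  move=> [_ [r _ <-] [_ [s _ <-] e]]; apply: m0.
  apply: (@filt1_fix _ _ _ _ F _ (r * rx + s * ry)).
    by apply: (filtD (f := F)); apply: filtMr.
  by rewrite scalerDl -!scalerA -xe -ye.
apply/seteqP; split=> [z [mz zL]|z Xz].
  apply: zL; split=> // [e|Y sY XY Ym].
    by apply: mX; rewrite e; apply: cyc_id.
  case: (pselect (Y `<=` X)) => [YX|]; first by left; apply/seteqP.
  move=> /existsNP[w /not_implyP[Yw Xw]]; right; apply/seteqP; split=> //.
  apply: cyc_sub => //; have /cycP[r we] := Ym _ Yw.
  have [c [d H]] := vtx_decomp vm sX Xa Xl r.
  have nz : fscal F v c d *: m <> 0.
    by move=> k0; apply: Xw; rewrite we -[_ *: m]subr0 -k0.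
  have [c' [d' e']] := fscal_scale_inv vm nz; rewrite -e'; apply: submoduleZ => //.
  rewrite (_ : fscal F v c d *: m = w - (r *: m - fscal F v c d *: m)).
    by apply: submoduleB => //; apply: XY.
  by rewrite we opprB addrC subrK.
split=> [|L [sL _ Lm neq max]]; first exact: Xm.
have Lr r : filt 1 r -> L (r *: m).
  move=> Fr; apply: contrapT => Lr.
  have sN := submodule_sum sL (submodule_cyc (r *: m)).
  have LN := @sub_sum_setl _ _ L _ (submodule_cyc (r *: m)).
  have rN := @sub_sum_setr _ _ _ (cyc (r *: m)) sL _ (cyc_id (r *: m)).
  have [|e|e] := max _ sN LN; last 2 first.
  - by apply: Lr; rewrite -e.
  - have : cyc m m by apply: cyc_id.
    rewrite -e => -[w Lw [_ [s _ <-] e']].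
    have /cycP[t mt] : cyc w m.
      apply: (@filt1_nakayama _ _ _ _ F _ 1 (s * r)); first exact: filtMr.
      by rewrite scale1r -scalerA e'.
    by apply: neq; apply/seteqP; split=> //; apply: cyc_sub => //; rewrite mt; apply: submoduleZ.
  apply: sum_set_sub => //; apply: cyc_sub => //; exact: cycZ.
by apply: (sum_set_sub sL _ _ Xz); apply: cyc_sub => //; rewrite ?xe ?ye; apply: Lr.
Qed.

Lemma biserial_of_arms m x y b b' : in_arr b x -> in_arr b' y ->
  Defs.rad (cyc m) = sum_set (cyc x) (cyc y) -> biserial (cyc m).
Proof.
move=> bx b'y radE; split; first exact: submodule_cyc.
have radm : Defs.rad (cyc m) `<=` cyc m by move=> z [].
have [x' [y' [bx' b'y' e W]]] := two_arms bx b'y.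
have sx' := submodule_cyc x'; have sy' := submodule_cyc y'.
exists (cyc x'), (cyc y'); split=> //.
- split; first exact: in_arr_uniserial bx'.
  by apply: subset_trans radm; rewrite radE e; apply: sub_sum_setl.
- split; first exact: in_arr_uniserial b'y'.
  by apply: subset_trans radm; rewrite radE e; apply: sub_sum_setr.
- by rewrite -/(sum_set _ _) -e -radE; apply: submodule_iso_refl.
Qed.

(** Only the arrows that end at [v] act on [m]: at most two at an ordinary vertex, and at a
    crease vertex at most one, which gives two arms because it can follow the loop. *)
Theorem vtx_cyc_biserial v m : m <> 0 -> vtx v *: m = m -> biserial (cyc m).
Proof.
move=> m0 vm.
have F0 := filt0 F 1.
have arr0 b : atgt b <> v -> arr b *: m = 0.
  by move=> bv; rewrite -vm scalerA arr_vtx0 // scale0r.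
have arrlp0 b : atgt b <> v -> (arr b * vloop v) *: m = 0.
  by move=> bv; rewrite arr_vloop0 // scale0r.
have sum0 x y : sum_set (cyc x) (cyc y) 0.
  by apply: submodule0; apply: submodule_sum; apply: submodule_cyc.
have sumx x y : sum_set (cyc x) (cyc y) x.
  by apply: sub_sum_setl; [apply: submodule_cyc|apply: cyc_id].
have sumy x y : sum_set (cyc x) (cyc y) y.
  by apply: sub_sum_setr; [apply: submodule_cyc|apply: cyc_id].
case: (pselect (exists b, atgt b = v)) => [[b bv]|nb]; last first.
  split; first exact: submodule_cyc.
  have u0 := uniserial0 M.
  have m0' : [set 0] `<=` cyc m by move=> _ ->; apply: submodule0; apply: submodule_cyc.
  exists [set 0], [set 0]; split=> //; last by right; rewrite setIid.
  rewrite (@rad_cyc v m 0 0 0 0) ?scale0r // => [|c|c]; rewrite ?cyc0.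
  - exact: submodule_iso_refl.
  - by rewrite arr0 -?cyc0 // => cv; apply: nb; exists c.
  - by rewrite arrlp0 -?cyc0 // => cv; apply: nb; exists c.
have [vC|vC] := boolP (v \in creases).
  apply: (@biserial_of_arms m (arr b *: m) ((arr b * vloop v) *: m) b b).
  - by exists m.
  - by exists (vloop v *: m); rewrite scalerA.
  have bb c : atgt c = v -> c = b.
    by move=> cv; apply: (crease_tgt (f := F)); rewrite cv.
  apply: (rad_cyc m0 vm) => //.
  - exact: filt_arr.
  - by apply: filtMl; apply: filt_arr.
  - by move=> c; case: (pselect (atgt c = v)) => [/bb->//|/arr0->].
  - by move=> c; case: (pselect (atgt c = v)) => [/bb->//|/arrlp0->].
have [b' b'v bb'] : exists2 b', atgt b' = v & forall c, atgt c = v -> c = b \/ c = b'.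
  case: (pselect (exists2 b', atgt b' = v & b' <> b)) => [[b' b'v ne]|nb'].
    exists b' => // c cv; have [] := @tgt_le2 _ _ _ _ F b b' c; rewrite ?bv //.
    - by move=> e; case: ne.
    - by left.
    - by right.
  exists b => // c cv; left; apply: contrapT => ne; apply: nb'; exists c => //.
apply: (@biserial_of_arms m (arr b *: m) (arr b' *: m) b b').
- by exists m.
- by exists m.
apply: (rad_cyc m0 vm) => //; try exact: filt_arr.
  by move=> c; case: (pselect (atgt c = v)) => [/bb'[]->//|/arr0->].
by move=> c; rewrite (vloop0 vC) mulr0 scale0r.
Qed.

End Biserial.

(** * Indecomposable projective modules *)

Section FreeCover.
Variables (R : nzRingType) (P : lmodType R).
Local Notation B := {malg R[P]}.

Definition free_eval (f : B) : P := \sum_(p <- msupp f) f@_p *: p.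

Lemma free_evalw (d : {fset P}) f : (msupp f `<=` d)%fset ->
  free_eval f = \sum_(p <- d) f@_p *: p.
Proof.
move=> le; rewrite /free_eval (big_fset_incl _ le) //= => p _ /mcoeff_outdom ->.
by rewrite scale0r.
Qed.

Lemma free_eval_linear : linear free_eval.
Proof.
move=> c f1 f2; set d := (msupp f1 `|` msupp f2 `|` msupp (c *: f1 + f2))%fset.
rewrite !(@free_evalw d) ?fsubsetUr //; first last.
- by rewrite /d -fsetUA fsubsetUl.
- by rewrite /d fsetUAC fsubsetUr.
rewrite scaler_sumr -big_split; apply: eq_bigr => p _ /=.
by rewrite mcoeffD mcoeffZ scalerDl scalerA.
Qed.

HB.instance Definition _ := GRing.isLinear.Build R B P *:%R free_eval free_eval_linear.

Definition free_coef (p : P) (f : B) : R^o := f@_p.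

Lemma free_coef_linear p : linear (free_coef p).
Proof. by move=> c f1 f2; rewrite /free_coef mcoeffD mcoeffZ. Qed.

HB.instance Definition _ p :=
  GRing.isLinear.Build R B R^o *:%R (free_coef p) (free_coef_linear p).

Lemma free_coverP : exists (B : lmodType R) (g : {linear B -> P})
    (co : P -> {linear B -> R^o}),
  (forall p, exists f, g f = p) /\
  forall f, exists s : seq P, g f = \sum_(p <- s) (co p f : R) *: p.
Proof.
exists B, free_eval, (fun p => free_coef p : {linear B -> R^o}); split=> [p|f].
  exists << p >>; rewrite /= (@free_evalw [fset p]%fset) ?msuppU_le //.
  by rewrite big_seq_fset1 mcoeffUU scale1r.
by exists (msupp f).
Qed.

End FreeCover.

(** Freeness enters the splitting argument only through the coordinate maps. *)
Lemma free_cover (R : pzRingType) (P : lmodType R) : (1 : R) <> 0 ->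
  exists (B : lmodType R) (g : {linear B -> P}) (co : P -> {linear B -> R^o}),
  (forall p, exists f, g f = p) /\
  forall f, exists s : seq P, g f = \sum_(p <- s) (co p f : R) *: p.
Proof.
(* The nontrivial ring built on [R] is convertible to [R] only once [R] is a
   constructor application. *)
move=> /eqP; case: R P => T c P R1.
pose R' : nzRingType := HB.pack T c (GRing.PzSemiRing_isNonZero.Build _ R1).
exact: (@free_coverP R' P).
Qed.

Section Projective.
Variables (K : fieldType) (R : pzRingType) (V E : finType).
Variable F : folded_ring K R V E.
Variable P : lmodType R.
Local Notation cst := (cst F).
Local Notation vtx := (vtx F).
Local Notation arr := (arr F).
Local Notation vloop := (vloop F).
Local Notation filt := (filt F).

(** The submodule [(filt n) P], as the least additive subset that contains the
    products. *)
Definition filt_span n (z : P) : Prop := forall X : set P,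
  X 0 -> (forall x y, X x -> X y -> X (x + y)) ->
  (forall r p, filt n r -> X (r *: p)) -> X z.

Lemma filt_span0 n : filt_span n 0. Proof. by move=> X. Qed.

Lemma filt_spanD n x y : filt_span n x -> filt_span n y -> filt_span n (x + y).
Proof. by move=> sx sy X X0 XD XZ; apply: (XD); [exact: sx X X0 XD XZ|exact: sy X X0 XD XZ]. Qed.

Lemma filt_spanZ n r p : filt n r -> filt_span n (r *: p).
Proof. by move=> Fr X _ _; apply. Qed.

(** Nakayama's lemma without finite generation: the radical of the ring is
    nilpotent. *)
Lemma filt_span_eq0 : (forall z, filt_span 1 z) -> forall z : P, z = 0.
Proof.
move=> top; have all_n n : forall z, filt_span n z.
  elim: n => [|n IH] z; first by rewrite -[z]scale1r; apply: filt_spanZ; apply: filt_all.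
  apply: IH; [exact: filt_span0|exact: filt_spanD|move=> r p Fr].
  apply: (top p (fun p => filt_span n.+1 (r *: p))); first by rewrite scaler0; apply: filt_span0.
    by move=> x y sx sy; rewrite scalerDr; apply: filt_spanD.
  by move=> s q Fs; rewrite scalerA -addn1; apply: filt_spanZ; apply: filtM.
have [n Fn] := filt_nil F; move=> z; apply: (all_n n z (fun z => z = 0)) => //.
  by move=> x y -> ->; rewrite addr0.
by move=> r p /Fn ->; rewrite scale0r.
Qed.

(** [vtx u * R * vtx u] is a local ring: its residue ring is the field at [u]. *)
Lemma not_filt1_unit u (r : R) : ~ filt 1 r -> vtx u * r = r -> r * vtx u = r ->
  exists s, s * r = vtx u.
Proof.
move=> nFr ur ru.
have sX : submodule (filt 1 : set R^o).
  by split=> [|a x y Fx Fy]; [apply: filt0|apply: (filtD (f := F)) => //; apply: filtMr].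
have [||c [d H]] := @vtx_decomp _ _ _ _ F R^o u (vtx u) _ (vtx_id F u) sX _ _ r.
- by move=> b; apply: filtMl; apply: filt_arr.
- by move=> b; apply: filtMl; apply: filtMl; apply: filt_arr.
pose k := fscal F u c d; pose j := r - k * vtx u.
have Fj : filt 1 j by rewrite /j -[X in X - _]ru.
have re : r = k * vtx u + j by rewrite /j addrC subrK.
have knz : k * vtx u <> 0 by move=> k0; apply: nFr; rewrite re k0 add0r.
have [c' [d' e]] := fscal_inv knz; pose k' := fscal F u c' d'.
have : cyc (r : R^o) (vtx u : R^o).
  apply: (@filt1_nakayama _ _ _ _ F R^o k' (- (k' * j))).
    by apply: filtN; apply: filtMr.
  rewrite /GRing.scale /= mulNr -[k' * j * _]mulrA.
  have -> : j * vtx u = j by rewrite /j mulrBl ru -mulrA vtx_id.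
  by rewrite -mulrBr re addrK mulrA e.
by move/cycP => [s e']; exists s.
Qed.

(** Some [m0] lies outside the radical of [P], hence so does one coordinate of its
    image under a section of a free cover.  That coordinate is
    a linear map [P -> R] whose value on [m0] is invertible at a vertex [v];
    after rescaling, [psi m = vtx v].  Then [psi] splits the map from [R vtx v] to [R m],
    and [P] is the direct sum of [R m] and the kernel of [psi]. *)
Lemma projective_cyclic : projective P -> indecomposable P ->
  exists v m, [/\ m <> 0, vtx v *: m = m & cyc m = [set: P]].
Proof.
move=> projP [P0 indP].
have R1 : (1 : R) <> 0.
  move=> R1; apply: P0; apply/seteqP; split=> // z _ /=.
  by rewrite -[z]scale1r R1 scale0r.
have [B [g [co [g_surj gE]]]] := free_cover P R1.
have [h hK] := projP B P g (idfun : {linear P -> P}) g_surj.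
have [m0 m0J] : exists m, ~ filt_span 1 m.
  apply/existsNP => top; apply: P0; apply/seteqP; split=> // z _.
  exact: filt_span_eq0.
have [p pJ] : exists p, ~ filt 1 (co p (h m0) : R).
  apply/existsNP => all1; apply: m0J; rewrite -[m0](hK m0).
  have [s ->] := gE (h m0); elim: s => [|p s IH]; first by rewrite big_nil; apply: filt_span0.
  by rewrite big_cons; apply: filt_spanD => //; apply: filt_spanZ; apply: all1.
pose phi (z : P) : R := co p (h z).
have phiD x y : phi (x + y) = phi x + phi y by rewrite /phi !linearD.
have phiZ r x : phi (r *: x) = r * phi x by rewrite /phi !linearZ.
have filt_sum (f : V -> R) : (forall v, filt 1 (f v)) -> filt 1 (\sum_v f v).
  move=> Ff; apply: (big_ind (filt 1)) => //; [exact: filt0|exact: filtD].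
have [v vJ] : exists v, ~ filt 1 (vtx v * phi m0).
  apply/existsNP => all1; apply: pJ; rewrite -/(phi m0) -[phi m0]mul1r -(vtx_sum F).
  by rewrite mulr_suml; apply: filt_sum.
pose r0 := vtx v * phi m0.
have [w wJ] : exists w, ~ filt 1 (r0 * vtx w).
  apply/existsNP => all1; apply: vJ; rewrite -/r0 -[r0]mulr1 -(vtx_sum F).
  by rewrite mulr_sumr; apply: filt_sum.
pose r := r0 * vtx w.
have vr : vtx v * r = r by rewrite /r /r0 !mulrA vtx_id.
have rw : r * vtx w = r by rewrite /r -mulrA vtx_id.
have vw : v = w.
  apply: contrapT => vw; apply: wJ; rewrite -/r.
  have sX : submodule (filt 1 : set R^o).
    by split=> [|a x y Fx Fy]; [apply: filt0|apply: (filtD (f := F)) => //; apply: filtMr].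
  have [||c [d H]] := @vtx_decomp _ _ _ _ F R^o w (vtx w) _ (vtx_id F w) sX _ _ r.
  - by move=> b; apply: filtMl; apply: filt_arr.
  - by move=> b; apply: filtMl; apply: filtMl; apply: filt_arr.
  have : filt 1 (vtx v * (r * vtx w - fscal F w c d * vtx w)) by apply: filtMr; apply: H.
  by rewrite rw mulrBr vr fscal_vtx mulrA vtx_ort // mul0r subr0.
subst w.
have [s sr] := not_filt1_unit wJ vr rw.
pose m := vtx v *: (s *: (vtx v *: m0)).
have vm : vtx v *: m = m by rewrite scalerA vtx_id.
pose psi z := phi z * vtx v.
have psim : psi m = vtx v.
  by rewrite /psi /m !phiZ -/r0 -!mulrA (mulrA (vtx v) (phi m0)) sr vtx_id.
have mnz : m <> 0.
  move=> mz; apply: wJ; rewrite -/r -rw -psim mz /psi -(scale0r 0) phiZ !mul0r mulr0.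
  exact: filt0.
exists v, m; split=> //.
pose ker : set P := [set z | psi z = 0].
have sk : submodule ker.
  split=> [|a x y]; rewrite /ker /psi /=; first by rewrite -(scale0r 0) phiZ !mul0r.
  by move=> x0 y0; rewrite phiD phiZ mulrDl -mulrA x0 y0 mulr0 addr0.
have dec z : sum_set (cyc m) ker z.
  exists (psi z *: m); first exact: cycZ.
  exists (z - psi z *: m); last by rewrite addrC subrK.
  have e : psi (psi z *: m) = psi z.
    by rewrite [in LHS]/psi phiZ -mulrA -/(psi m) psim /psi -mulrA vtx_id.
  rewrite /ker /= /psi -scaleN1r phiD phiZ mulrDl mulN1r mulNr -/(psi (_ *: m)) e.
  by rewrite -/(psi z) subrr.
have [|||e] := indP (cyc m) ker (submodule_cyc m) sk.
- by apply/seteqP; split=> // z _; apply: dec.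
- apply/seteqP; split=> [_ [/cycP[a ->] k0]|_ ->]; last first.
    by split; apply: submodule0 => //; apply: submodule_cyc.
  move: k0; rewrite /ker /= /psi phiZ -mulrA -/(psi m) psim => av.
  by rewrite -vm scalerA av scale0r.
- by move=> e; case: mnz; have := cyc_id m; rewrite e.
apply/seteqP; split=> // z _; have [y my [k]] := dec z.
by rewrite e => -> <-; rewrite addr0.
Qed.

Lemma projective_biserial : projective P -> indecomposable P -> biserial [set: P].
Proof.
move=> projP indP; have [v [m [m0 vm <-]]] := projective_cyclic projP indP.
exact: vtx_cyc_biserial m0 vm.
Qed.

End Projective.

(** * Paths and their degrees *)

Section PathAlgebraTheory.
Variables (K : fieldType) (Q : quiver).
Local Notation KQ := (path_algebra K Q).
Implicit Types (f g : KQ) (p q r : qpath Q) (a : arrow Q).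

Lemma pelt_mul p q : ptgt p = psrc q ->
  exists r, [/\ pelt K p * pelt K q = pelt K r, psrc r = psrc p
              & arrows r = arrows p ++ arrows q].
Proof.
move=> e; have [r [e' r1 _ r3]] := @pmul_basis_some K Q p q e.
by exists r; split=> //; apply: etrans (pmulUU K p q) e'.
Qed.

Lemma pelt_mul0 p q : ptgt p <> psrc q -> pelt K p * pelt K q = 0.
Proof. by move=> e; apply: etrans (pmulUU K p q) (pmul_basis_none K e). Qed.

Lemma pelt_nil p : arrows p = [::] -> pelt K p = peps K (psrc p).
Proof. by move=> e; congr pelt; apply: qpath_eq. Qed.

Lemma pelt_cons p a s : arrows p = a :: s ->
  exists2 q, arrows q = s & pelt K p = parr K a * pelt K q.
Proof.
move=> e; have := qpath_walk p; rewrite -/(arrows p) -/(psrc p) e /= => /andP[/eqP ap w].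
pose q := @QPath Q (tgt a, s) w; exists q => //.
have [|r [-> r1 r2]] := @pelt_mul (arrow_path a) q; first by [].
by congr pelt; apply: qpath_eq; rewrite ?r1 ?r2 //= -ap.
Qed.

Lemma pmul_scaler c (f g : {malg K[qpath Q]}) : pmul f (c *: g) = c *: pmul f g.
Proof.
rewrite -[X in pmul _ X]addr0; apply: etrans (pmul_linearr f c g 0) _.
by rewrite (pmul0r f); exact: addr0.
Qed.

Lemma path_scalerAr c f g : c *: (f * g) = f * (c *: g).
Proof. exact: esym (pmul_scaler c f g). Qed.

Lemma pelt_sumE f : f = \sum_(p <- msupp (f : {malg K[qpath Q]})) f@_p *: pelt K p.
Proof.
by rewrite [LHS](@monalgE _ _ f); apply: eq_bigr => p _; apply: malgUE.
Qed.

Lemma path_algebra_ind (P : KQ -> Prop) : P 0 ->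
  (forall f g, P f -> P g -> P (f + g)) -> (forall c p, P (c *: pelt K p)) ->
  forall f, P f.
Proof. by move=> P0 PD Pp f; rewrite (pelt_sumE f); apply: (big_ind P). Qed.

Lemma pelt_coef p q : (pelt K p : {malg K[qpath Q]})@_q = (p == q)%:R.
Proof. by rewrite /pelt pbase.unlock mcoeffU. Qed.

End PathAlgebraTheory.

Definition deg (K : fieldType) (T : folded_data K) (p : qpath (fquiver T)) : nat :=
  count (@ordinary K T) (arrows p).

HB.lock Definition hcomp (K : fieldType) (T : folded_data K) (n : nat)
    (f : {malg K[qpath (fquiver T)]}) : {malg K[qpath (fquiver T)]} :=
  \sum_(p <- msupp f) << (if deg p == n then f@_p else 0) *g p >>.

Section Degree.
Variables (K : fieldType) (T : folded_data K).
Local Notation Q := (fquiver T).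
Local Notation KQ := (path_algebra K Q).
Local Notation malgQ := {malg K[qpath Q]}.
Local Notation I := (ideal_gen (@relations K T)).
Implicit Types (f g : KQ) (p q r : qpath Q) (a : arrow Q).

Definition deg_ge n : set KQ := [set f | forall p, (f : malgQ)@_p <> 0 -> (n <= deg p)%N].

Lemma deg_ge0 n : deg_ge n 0. Proof. by move=> p; rewrite mcoeff0. Qed.

Lemma deg_geD n f g : deg_ge n f -> deg_ge n g -> deg_ge n (f + g).
Proof.
move=> df dg p; rewrite mcoeffD => fg; case: (pselect ((f : malgQ)@_p = 0)) => [f0|/df//].
by apply: dg => g0; apply: fg; rewrite f0 g0 addr0.
Qed.

Lemma deg_geZ n c f : deg_ge n f -> deg_ge n (c *: f).
Proof.
by move=> df p; rewrite mcoeffZ => cf; apply: df => f0; apply: cf; rewrite f0 mulr0.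
Qed.

Lemma deg_ge_pelt p n : (n <= deg p)%N -> deg_ge n (pelt K p).
Proof. by move=> np q; rewrite pelt_coef; case: eqP => [<-|]. Qed.

Lemma deg_geM m n f g : deg_ge m f -> deg_ge n g -> deg_ge (m + n)%N (f * g).
Proof.
move=> df dg; rewrite [f * g](@pmulw _ _ _ _ f g (fsubset_refl _) (fsubset_refl _)).
apply: (big_ind (deg_ge (m + n)%N)) => [||p _]; [exact: deg_ge0|exact: deg_geD|].
apply: (big_ind (deg_ge (m + n)%N)) => [||q _]; [exact: deg_ge0|exact: deg_geD|].
have [f0|/eqP f0] := eqVneq ((f : malgQ)@_p) 0.
  by rewrite f0 mul0r scale0r; apply: deg_ge0.
have [g0|/eqP g0] := eqVneq ((g : malgQ)@_q) 0.
  by rewrite g0 mulr0 scale0r; apply: deg_ge0.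
apply: deg_geZ; case: (pselect (ptgt p = psrc q)) => [e|e]; last first.
  by rewrite pmul_basis_none //; apply: deg_ge0.
have [r [-> _ _ r3]] := @pmul_basis_some K Q p q e; apply: deg_ge_pelt.
by rewrite /deg r3 count_cat leq_add //; [apply: df|apply: dg].
Qed.

Lemma hcomp_coef n (f : malgQ) q :
  (hcomp n f)@_q = if deg q == n then f@_q else 0.
Proof.
rewrite hcomp.unlock raddf_sum /=.
under eq_bigr => p _ do rewrite mcoeffU.
have [qf|qf] := boolP (q \in msupp f); last first.
  rewrite (mcoeff_outdom qf) if_same big_seq big1 // => p pf.
  by case: (p =P q) => [e|]; rewrite ?mulr0n //; move: qf; rewrite -e pf.
rewrite (big_fsetD1 q) //= eqxx mulr1n big1_fset ?addr0 // => p.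
by rewrite in_fsetD1 => /andP[/negPf -> _]; rewrite mulr0n.
Qed.

Lemma hcomp_linear n : linear (@hcomp K T n : malgQ -> malgQ).
Proof.
move=> c f g; apply/malgP => q.
by rewrite mcoeffD mcoeffZ !hcomp_coef mcoeffD mcoeffZ; case: eqP => // _; rewrite mulr0 addr0.
Qed.

(** [hcomp] with the types of the path algebra, whose products it has to
    respect. *)
Definition hpart n (f : KQ) : KQ := hcomp n f.

HB.instance Definition _ n := GRing.isLinear.Build K KQ KQ *:%R (hpart n) (hcomp_linear n).

Lemma hpart_pelt n p : hpart n (pelt K p) = if deg p == n then pelt K p else 0.
Proof.
apply/malgP => q; apply: etrans (hcomp_coef n _ q) _; case: (eqVneq p q) => [->|pq].
  by case: ifP => _; rewrite ?mcoeff0.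
have c0 : (pelt K p : malgQ)@_q = 0 by rewrite pelt_coef (negPf pq).
by rewrite c0 if_same; case: ifP => _; rewrite ?mcoeff0.
Qed.

Lemma hpart_mull n p f : hpart n (pelt K p * f) =
  if (deg p <= n)%N then pelt K p * hpart (n - deg p)%N f else 0.
Proof.
elim/path_algebra_ind: f => [|f g Hf Hg|c q].
- by rewrite mulr0 !linear0 mulr0 if_same.
- rewrite mulrDr !linearD /= Hf Hg mulrDr; case: ifP => // _; exact: addr0.
rewrite -path_scalerAr !linearZ /= -path_scalerAr.
suff -> : hpart n (pelt K p * pelt K q) =
    if (deg p <= n)%N then pelt K p * hpart (n - deg p)%N (pelt K q) else 0.
  by case: ifP => // _; rewrite scaler0.
rewrite hpart_pelt; case: (pselect (ptgt p = psrc q)) => [e|e]; last first.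
  by rewrite (fun_if (fun x => _ * x)) mulr0 pelt_mul0 // linear0 !if_same.
have [r [er _ r2]] := pelt_mul K e; rewrite (fun_if (fun x => _ * x)) mulr0 er hpart_pelt.
rewrite /deg r2 count_cat -!/(deg _); have [le|gt] := leqP (deg p) n.
  by rewrite -(eqn_add2l (deg p) (deg q)) subnKC.
by rewrite gtn_eqF // (leq_trans gt) // leq_addr.
Qed.

Lemma hpart_mulr n p f : hpart n (f * pelt K p) =
  if (deg p <= n)%N then hpart (n - deg p)%N f * pelt K p else 0.
Proof.
elim/path_algebra_ind: f => [|f g Hf Hg|c q].
- by rewrite mul0r !linear0 mul0r if_same.
- rewrite mulrDl !linearD /= Hf Hg mulrDl; case: ifP => // _; exact: addr0.
rewrite path_scalerAl !linearZ /= path_scalerAl.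
suff -> : hpart n (pelt K q * pelt K p) =
    if (deg p <= n)%N then hpart (n - deg p)%N (pelt K q) * pelt K p else 0.
  by case: ifP => // _; rewrite scaler0.
rewrite hpart_pelt; case: (pselect (ptgt q = psrc p)) => [e|e]; last first.
  by rewrite (fun_if (fun x => x * _)) mul0r pelt_mul0 // linear0 !if_same.
have [r [er _ r2]] := pelt_mul K e; rewrite (fun_if (fun x => x * _)) mul0r er hpart_pelt.
rewrite /deg r2 count_cat -!/(deg _); have [le|gt] := leqP (deg p) n.
  by rewrite -(eqn_add2r (deg p) (deg q)) subnK.
by rewrite gtn_eqF // (leq_trans gt) // leq_addl.
Qed.

Lemma ideal0 : I 0. Proof. by have [] := ideal_gen_ideal (@relations K T). Qed.

Lemma idealB f g : I f -> I g -> I (f - g).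
Proof. by have [_ h _] := ideal_gen_ideal (@relations K T); apply: h. Qed.

Lemma idealD f g : I f -> I g -> I (f + g).
Proof. by move=> If Ig; rewrite -[g]opprK -[- g]sub0r; apply: idealB => //; apply: idealB => //; apply: ideal0. Qed.

Lemma idealMl f g : I g -> I (f * g).
Proof. by have [_ _ h] := ideal_gen_ideal (@relations K T); move=> /(h f)[]. Qed.

Lemma idealMr f g : I f -> I (f * g).
Proof. by have [_ _ h] := ideal_gen_ideal (@relations K T); move=> /(h g)[]. Qed.

Lemma idealZ c f : I f -> I (c *: f).
Proof. by move=> If; rewrite -[f]mulr1 path_scalerAr; apply: idealMr. Qed.

Lemma ideal_rel f : relations f -> I f.
Proof. by move=> rf J [_]; apply. Qed.

Hypothesis T_gentle : folded_gentle T.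

Lemma eta_crease_loop v : v \in crease T -> crease_loop (Defs.eta T v).
Proof. by move=> vC; apply/existsP; exists v; rewrite vC eqxx. Qed.

Lemma eta_path v : v \in crease T -> exists2 p, parr K (Defs.eta T v) ^+ 2 = pelt K p & deg p = 0%N.
Proof.
move=> vC; have [s t] := eta_loop T_gentle vC.
have [|r [e _ r2]] := @pelt_mul K Q (arrow_path (Defs.eta T v)) (arrow_path (Defs.eta T v)).
  by rewrite /ptgt /= t /psrc /= s.
by exists r; rewrite // /deg r2 /= /ordinary eta_crease_loop.
Qed.

(** The generators are homogeneous for the number of ordinary arrows: a path has its
    own degree, and all terms of a crease relation have degree 0. *)
Lemma ideal_hpart n f : I f -> I (hpart n f).
Proof.
move=> If; move: n; apply: (If [set f | forall n, I (hpart n f)]); split; last first.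
  move=> _ [[p rp <-]|[v vC <-]] n.
    rewrite hpart_pelt; case: ifP => _; last exact: ideal0.
    by apply: ideal_rel; left; exists p.
  pose homog0 (f : KQ) := hpart n f = if n == 0%N then f else 0.
  have homogB x y : homog0 x -> homog0 y -> homog0 (x - y).
    by rewrite /homog0 linearB /= => -> ->; case: ifP => // _; rewrite subr0.
  have homogZ c x : homog0 x -> homog0 (c *: x).
    by rewrite /homog0 linearZ /= => ->; case: ifP => // _; rewrite scaler0.
  have homog_pelt p : deg p = 0%N -> homog0 (pelt K p).
    by move=> p0; rewrite /homog0 hpart_pelt p0 eq_sym.
  have -> : hpart n (crease_relation v) = if n == 0%N then crease_relation v else 0.
    have [p pe p0] := eta_path vC.
    have h2 : homog0 (parr K (Defs.eta T v) ^+ 2) by rewrite pe; exact: homog_pelt.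
    have h1 : homog0 (parr K (Defs.eta T v)).
      by apply: homog_pelt; rewrite /deg /= /ordinary eta_crease_loop.
    exact: homogB (homogB _ _ h2 (homogZ _ _ h1)) (homogZ _ _ (homog_pelt _ _)).
  case: ifP => _; last exact: ideal0.
  by apply: ideal_rel; right; exists v.
split=> [n|f1 g1 If1 Ig1 n|a g1 Ig1]; first by rewrite linear0; apply: ideal0.
  by rewrite linearB; apply: idealB; [apply: If1|apply: Ig1].
split=> n; elim/path_algebra_ind: a => [|a b Ha Hb|c p].
- by rewrite mul0r linear0; apply: ideal0.
- by rewrite mulrDl linearD; apply: idealD.
- rewrite path_scalerAl linearZ /= hpart_mull; apply: idealZ.
  by case: ifP => _; [apply: idealMl|apply: ideal0].
- by rewrite mulr0 linear0; apply: ideal0.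
- by rewrite mulrDr linearD; apply: idealD.
rewrite -path_scalerAr linearZ /= hpart_mulr; apply: idealZ.
by case: ifP => _; [apply: idealMr|apply: ideal0].
Qed.

Hypothesis A_findim : @finite_dim K (folded_algebra T).

(** If every degree had a path outside the ideal, more of these than
    the dimension of the algebra would satisfy a linear relation, whose homogeneous
    parts lie in the ideal. *)
Lemma deg_bound : exists n, forall p, deg p = n -> I (pelt K p).
Proof.
apply: contrapT => /forallNP nobound.
have [P HP] : {P : nat -> qpath Q & forall n, deg (P n) = n /\ ~ I (pelt K (P n))}.
  apply: (@choice _ _ (fun n p => deg p = n /\ ~ I (pelt K p))) => n.
  by have /existsNP[p /not_implyP[]] := nobound n; exists p.
have [d [b span]] := A_findim.
have [C HC] : {C : 'I_d.+1 -> 'I_d -> K & forall i : 'I_d.+1,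
    (qproj (@relations K T) (pelt K (P i)) : folded_algebra T) = \sum_(j < d) C i j *: b j}.
  apply: (@choice _ _ (fun (i : 'I_d.+1) c => _ = \sum_(j < d) c j *: b j)) => i.
  exact: span.
(* The rows of [Cm] are [d + 1] vectors of length [d]; a left null vector of [Cm] is
   the linear relation. *)
pose Cm : 'M[K]_(d.+1, d) := \matrix_(i, j) C i j.
have : kermx Cm != 0.
  by rewrite -mxrank_eq0 mxrank_ker -lt0n subn_gt0 ltnS rank_leq_col.
move=> /rowV0Pn[u /sub_kermxP uC u0].
have [k uk] : exists k, u 0 k != 0.
  apply/existsP; apply: contraNT u0 => /existsPn u0; apply/eqP/rowP => k.
  by rewrite mxE; apply/eqP; rewrite -[_ == _]negbK u0.
pose f : KQ := \sum_i u 0 i *: pelt K (P i).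
have If : I f.
  suff : qproj (@relations K T) f = qproj (@relations K T) 0 by move/qprojE; rewrite subr0.
  have pi0 : qproj (@relations K T) 0 = 0.
    by apply: (addrI (qproj (@relations K T) 0)); rewrite -qprojD !addr0.
  rewrite pi0 /f (big_morph _ (@qprojD _ _ _) pi0).
  under eq_bigr => i _ do rewrite qprojZ HC.
  transitivity (\sum_i \sum_(j < d) (u 0 i * C i j) *: b j).
    apply: eq_bigr => i _; transitivity (u 0 i *: \sum_(j < d) C i j *: b j); first by [].
    by rewrite scaler_sumr; apply: eq_bigr => j _; rewrite scalerA.
  rewrite exchange_big big1 // => j _; rewrite -scaler_suml.
  have := congr1 (fun M : 'rV_d => M 0 j) uC; rewrite !mxE.
  by under eq_bigr => i _ do rewrite mxE; move=> ->; rewrite scale0r.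
have := ideal_hpart k If; rewrite /f linear_sum (bigD1 k) //= big1 => [|i ik].
  rewrite addr0 linearZ /= hpart_pelt (HP k).1 eqxx => /(idealZ (u 0 k)^-1).
  by rewrite scalerA mulVf // scale1r => /(HP k).2.
rewrite linearZ /= hpart_pelt (HP i).1; case: eqP => [/val_inj e|]; last by rewrite scaler0.
by rewrite e eqxx in ik.
Qed.

(** A path of larger degree has a final segment of exactly the critical degree. *)
Lemma deg_ge_bound : exists n, forall f, deg_ge n f -> I f.
Proof.
have [n Hn] := deg_bound; exists n.
have Hp p : (n <= deg p)%N -> I (pelt K p).
  move e: (arrows p) => s; elim: s p e => [|a s IH] p e np.
    by apply: Hn; apply/eqP; rewrite eqn_leq np andbT /deg e.
  have [q eq pe] := pelt_cons K e; have [nq|nq] := leqP n (deg q).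
    by rewrite pe; apply: idealMl; apply: IH.
  apply: Hn; apply/eqP; rewrite eqn_leq np andbT /deg e /= -eq -/(deg q).
  by case: (ordinary a); rewrite ?add0n ?add1n // ltnW.
move=> f df; rewrite (pelt_sumE f).
apply: (big_ind I) => [||p _]; [exact: ideal0|exact: idealD|].
have [->|/eqP f0] := eqVneq ((f : malgQ)@_p) 0; first by rewrite scale0r; apply: ideal0.
by apply: idealZ; apply: Hp; apply: df.
Qed.

End Degree.

(** * Folded gentle algebras *)

Lemma card_le2_pigeonhole (X : finType) (P : pred X) (a b c : X) :
  (#|P| <= 2)%N -> P a -> P b -> P c -> [\/ a = b, a = c | b = c].
Proof.
move=> P2 Pa Pb Pc; have [->|ab] := eqVneq a b; first by constructor 1.
have [->|ac] := eqVneq a c; first by constructor 2.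
have [->|bc] := eqVneq b c; first by constructor 3.
have : (size [:: a; b; c] <= #|P|)%N.
  rewrite -(@card_uniqP _ [:: a; b; c] _); first last.
    by rewrite /= !inE negb_or ab ac bc.
  apply: subset_leq_card; apply/fintype.subsetP => x.
  by rewrite !inE => /or3P[] /eqP ->.
by move=> /leq_trans/(_ P2).
Qed.

(** If [y] were nonzero, [- x / y] would be a root of the irreducible quadratic. *)
Lemma irreducible_norm_eq0 (K : fieldType) (l1 l2 x y : K) :
  irreducible_poly ('X^2 - l1%:P * 'X - l2%:P) ->
  x * x + l1 * x * y - l2 * y * y = 0 -> y = 0.
Proof.
move=> [_ irr] n0; apply/eqP; apply: contraT => y0.
pose t := - x / y; pose P : {poly K} := 'X^2 - l1%:P * 'X - l2%:P.
(* The roots add up to [l1]. *)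
have e : P = ('X - t%:P) * ('X - (l1 - t)%:P).
  have l2E : l2 = t * t - l1 * t.
    apply/eqP; rewrite -subr_eq0; apply/eqP.
    transitivity (- (x * x + l1 * x * y - l2 * y * y) / (y * y)); first by rewrite /t; field.
    by rewrite n0 oppr0 mul0r.
  by rewrite /P l2E !(polyCB, polyCM); ring.
have : 'X - t%:P %= P by apply: irr; rewrite ?size_XsubC // -/P e dvdp_mulr.
by move/eqp_size; rewrite e size_mul ?polyXsubC_eq0 // !size_XsubC.
Qed.

Section FoldedGentleAlgebra.
Variables (K : fieldType) (T : folded_data K).
Hypothesis T_gentle : folded_gentle T.
Hypothesis A_findim : @finite_dim K (folded_algebra T).
Local Notation Q := (fquiver T).
Local Notation KQ := (path_algebra K Q).
Local Notation A := (folded_algebra T).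
Implicit Types (f g : KQ) (p q r : qpath Q) (u v : vertex Q).

Definition fproj (f : KQ) : A := qproj (@relations K T) f.

Lemma fprojD f g : fproj (f + g) = fproj f + fproj g.
Proof. exact: qprojD. Qed.

Lemma fprojM f g : fproj (f * g) = fproj f * fproj g.
Proof. exact: qprojM. Qed.

Lemma fproj_eq0 f : ideal_gen (@relations K T) f -> fproj f = 0.
Proof.
move=> If; have -> : 0 = fproj 0.
  by apply: (addrI (fproj 0)); rewrite -fprojD !addr0.
by apply/qprojE; rewrite subr0.
Qed.

Lemma fproj0 : fproj 0 = 0. Proof. by apply: fproj_eq0; apply: ideal0. Qed.

Lemma fproj_surj (x : A) : exists f, x = fproj f.
Proof. by exists (qrepr x); rewrite /fproj qreprK. Qed.

Definition oarrow := {a : arrow Q | @ordinary K T a}.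
Implicit Types (a b : oarrow).

Lemma src_le2_pigeonhole (x y z : arrow Q) : src x = src y -> src x = src z ->
  [\/ x = y, x = z | y = z].
Proof.
move=> xy xz; apply: (card_le2_pigeonhole (FG1 T_gentle (src x)).1); rewrite /= ?eqxx //.
  by rewrite xy.
by rewrite xz.
Qed.

Lemma tgt_le2_pigeonhole (x y z : arrow Q) : tgt x = tgt y -> tgt x = tgt z ->
  [\/ x = y, x = z | y = z].
Proof.
move=> xy xz; apply: (card_le2_pigeonhole (FG1 T_gentle (tgt x)).2); rewrite /= ?eqxx //.
  by rewrite xy.
by rewrite xz.
Qed.

Lemma ordinary_neq_eta a v : v \in crease T -> val a <> Defs.eta T v.
Proof.
by move=> vC e; have := valP a; rewrite /ordinary e eta_crease_loop.
Qed.

Definition farr a : A := fproj (parr K (val a)).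
Definition floop v : A :=
  if v \in crease T then fproj (parr K (Defs.eta T v)) else 0.
Definition fcst (c : K) : A := fproj (c *: (1 : KQ)).
Definition ffilt n : set A := [set fproj f | f in @deg_ge K T n].

Lemma idemE v : idem v = fproj (peps K v). Proof. by []. Qed.

Lemma pair_path (x y : arrow Q) : tgt x = src y ->
  exists2 p, arrows p = [:: x; y] & parr K x * parr K y = pelt K p.
Proof.
move=> xy; have [|p [e _ p2]] := @pelt_mul K Q (arrow_path x) (arrow_path y); first by [].
by exists p.
Qed.

Lemma farr_pair a b : farr a * farr b <> 0 -> pair_notin (val a) (val b).
Proof.
rewrite /farr -fprojM => nz.
have e : tgt (val a) = src (val b).
  by apply: contrapT => ab; apply: nz; rewrite [parr _ _ * _]pelt_mul0 ?fproj0.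
have [p p2 pe] := pair_path e; exists p => // rp; apply: nz.
by rewrite pe; apply: fproj_eq0; apply: ideal_rel; left; exists p.
Qed.

(** The loop and [a] both end at the source of [b], and the loop followed by [b] is
    never a relation; the gentle condition leaves no room for [a]. *)
Lemma farr_crease a b : tgt (val a) = src (val b) -> tgt (val a) \in crease T ->
  farr a * farr b = 0.
Proof.
move=> ab aC; have [s t] := eta_loop T_gentle aC.
apply: contrapT => /farr_pair nab.
have [p' p'2 _] : exists2 p', arrows p' = [:: Defs.eta T (tgt (val a)); val b]
    & parr K (Defs.eta T (tgt (val a))) * parr K (val b) = pelt K p'.
  by apply: pair_path; rewrite t.
have neb : pair_notin (Defs.eta T (tgt (val a))) (val b).
  exists p' => // /(rel1_ordinary T_gentle)[_].
  by rewrite p'2 /= /ordinary eta_crease_loop.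
have [h _] := FG2 T_gentle (valP b).
exact: (ordinary_neq_eta aC (h _ _ nab neb)).
Qed.

Lemma fcst_scale c f : fcst c * fproj f = fproj (c *: f).
Proof. by rewrite /fcst -fprojM path_scalerAl mul1r. Qed.

Lemma folded_algebra_gen (P : A -> Prop) :
  (forall c, P (fcst c)) -> (forall v, P (idem v)) -> (forall b, P (farr b)) ->
  (forall v, P (floop v)) -> (forall x y, P x -> P y -> P (x + y)) ->
  (forall x y, P x -> P y -> P (x * y)) -> forall x, P x.
Proof.
move=> Ps Pv Pa Pl PD PM x; have [f ->] := fproj_surj x.
have P0 : P 0.
  by have := Ps 0; rewrite /fcst scale0r fproj0.
have Parr (a : arrow Q) : P (fproj (parr K a)).
  have [oa|] := boolP (@ordinary K T a); first exact: (Pa (exist _ a oa)).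
  rewrite /ordinary negbK => /existsP[v /andP[vC /eqP ->]].
  by have := Pl v; rewrite /floop vC.
have Ppath p : P (fproj (pelt K p)).
  move e: (arrows p) => s; elim: s p e => [|a s IH] p e.
    by rewrite pelt_nil //; apply: Pv.
  by have [q eq ->] := pelt_cons K e; rewrite fprojM; apply: (PM) => //; apply: IH.
elim/path_algebra_ind: f => [|f g Pf Pg|c p]; first by rewrite fproj0.
  by rewrite fprojD; apply: PD.
by rewrite -fcst_scale; apply: PM.
Qed.

Lemma idemM u v : (idem u : A) * idem v = if u == v then idem u else 0.
Proof.
rewrite !idemE -fprojM /peps.
case: eqVneq => [<-|uv]; last by rewrite pelt_mul0 ?fproj0 //; apply/eqP.
have [|r [-> r1 r2]] := @pelt_mul K Q (stationary u) (stationary u); first by [].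
by congr (fproj (pelt _ _)); apply: qpath_eq.
Qed.

Lemma idem_sum : \sum_v (idem v : A) = 1.
Proof. by have := big_morph fproj fprojD fproj0 => /(_ _ _ xpredT (@peps K Q)) <-. Qed.

Lemma peps_parr (x : arrow Q) : peps K (src x) * parr K x = parr K x.
Proof.
have [|r [e r1 r2]] := @pelt_mul K Q (stationary (src x)) (arrow_path x); first by [].
by rewrite [LHS]e; congr pelt; apply: qpath_eq.
Qed.

Lemma parr_peps (x : arrow Q) : parr K x * peps K (tgt x) = parr K x.
Proof.
have [|r [e r1 r2]] := @pelt_mul K Q (arrow_path x) (stationary (tgt x)); first by [].
by rewrite [LHS]e; congr pelt; apply: qpath_eq.
Qed.

Lemma floop_sqr v : v \in crease T ->
  floop v * floop v = fcst (lambda1 T v) * floop v + fcst (lambda2 T v) * idem v.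
Proof.
move=> vC; rewrite /floop vC; set h := parr K _.
have e : fproj (h * h) = fproj (lambda1 T v *: h + lambda2 T v *: peps K v).
  by apply/qprojE; rewrite opprD addrA; apply: ideal_rel; right; exists v.
apply: etrans (esym (fprojM h h)) _; rewrite e fprojD.
congr (_ + _); exact: esym (fcst_scale _ _).
Qed.

Definition folded_gentle_ring : folded_ring K A (vertex Q) oarrow.
Proof.
refine (@FoldedRing K A (vertex Q) oarrow fcst (@idem K T) farr floop
  (fun a => src (val a)) (fun a => tgt (val a)) (crease T) (lambda1 T) (lambda2 T) ffilt
  _ _ _ _ idemM idem_sum _ _ _ _ _ floop_sqr _ folded_algebra_gen
  _ _ _ _ farr_crease _ _ _ _ _ _ _ _).
- by move=> c d; rewrite /fcst scalerDl fprojD.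
- by move=> c d; rewrite fcst_scale /fcst scalerA.
- by rewrite /fcst scale1r.
- move=> c x; have [f ->] := fproj_surj x.
  by rewrite fcst_scale /fcst -fprojM -path_scalerAr mulr1.
- by move=> b; rewrite idemE /farr -fprojM peps_parr.
- by move=> b; rewrite idemE /farr -fprojM parr_peps.
- move=> v; rewrite /floop; case: ifP => vC; last by rewrite mulr0.
  rewrite idemE -fprojM; have [s t] := eta_loop T_gentle vC.
  by rewrite -{1}s peps_parr.
- move=> v; rewrite /floop; case: ifP => vC; last by rewrite mul0r.
  rewrite idemE -fprojM; have [s t] := eta_loop T_gentle vC.
  by rewrite -{2}t parr_peps.
- by move=> v /negPf vC; rewrite /floop vC.
- by move=> v c d vC; apply: irreducible_norm_eq0 (FG5 T_gentle vC).
- move=> a b c ab ac; have [e|e|e] := src_le2_pigeonhole ab ac; [constructor 1|constructor 2|constructor 3];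
    exact: val_inj.
- move=> a b c ab ac; have [e|e|e] := tgt_le2_pigeonhole ab ac; [constructor 1|constructor 2|constructor 3];
    exact: val_inj.
- move=> a b aC ab; have [s t] := eta_loop T_gentle aC.
  have [|/val_inj//|e|e] := @src_le2_pigeonhole (val a) (val b) (Defs.eta T (src (val a))) ab.
  + by rewrite s.
  + by case: (ordinary_neq_eta aC e).
  + by case: (ordinary_neq_eta aC e).
- move=> a b aC ab; have [s t] := eta_loop T_gentle aC.
  have [|/val_inj//|e|e] := @tgt_le2_pigeonhole (val a) (val b) (Defs.eta T (tgt (val a))) ab.
  + by rewrite t.
  + by case: (ordinary_neq_eta aC e).
  + by case: (ordinary_neq_eta aC e).
- move=> a a' b /farr_pair h /farr_pair h'; apply: val_inj.
  by have [u _] := FG2 T_gentle (valP b); apply: u h h'.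
- move=> a b b' /farr_pair h /farr_pair h'; apply: val_inj.
  by have [_ u] := FG2 T_gentle (valP a); apply: u h h'.
- by move=> x; have [f ->] := fproj_surj x; exists f.
- by move=> n; exists 0; [exact: deg_ge0|exact: fproj0].
- move=> n _ _ [f df <-] [g dg <-]; exists (f + g); [exact: deg_geD|exact: fprojD].
- move=> m n _ _ [f df <-] [g dg <-]; exists (f * g); [exact: deg_geM|exact: fprojM].
- by move=> b; exists (parr K (val b)) => //; apply: deg_ge_pelt; rewrite /deg /= (valP b).
- have [n Hn] := deg_ge_bound T_gentle A_findim; exists n => _ [f df <-].
  by apply: fproj_eq0; apply: Hn.
Defined.

End FoldedGentleAlgebra.

Theorem theorem3p4 (K : fieldType) (T : folded_data K)
    (T_gentle : folded_gentle T)
    (T_crease : exists v : vertex (fquiver T), v \in crease T)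
    (A_findim : @finite_dim K (folded_algebra T)) :
  [/\ forall (M : lmodType (folded_algebra T)) (m : M) (v : vertex (fquiver T)),
        m <> 0 -> idem v *: m = m -> biserial (cyclic_submodule m),
      forall (M : lmodType (folded_algebra T)^c) (m : M) (v : vertex (fquiver T)),
        m <> 0 -> (idem v : (folded_algebra T)^c) *: m = m ->
        biserial (cyclic_submodule m)
    & biserial_algebra (folded_algebra T)].
Proof.
pose F := folded_gentle_ring T_gentle A_findim; pose Fc := converse_folded_ring F.
split.
- by move=> M m v m0 vm; rewrite cyclic_submoduleE; apply: (vtx_cyc_biserial (F := F) m0 vm).
- by move=> M m v m0 vm; rewrite cyclic_submoduleE; exact: (@vtx_cyc_biserial _ _ _ _ Fc M v m m0 vm).
- by split=> P; [apply: (projective_biserial F)|apply: (projective_biserial Fc)].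
Qed.
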